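(* Consider, without loss of generality, a self-similar curve in $\mathbb{R}^3$ of the form $\Gamma(x)=(x,y(x),z(x))$ that is rotating in space under the Vortex Filament Equation, and let $\Gamma^x,\Gamma^y,\Gamma^z$ denote its components along the $x$, $y$ and $z$ axes. Rotating self-similar solutions around a single axis split into the following two cases. (1) Rotation around the $z$ or $y$ axis. For rotation around the $y$-axis, the curve is described by $$\Gamma^x=x,\qquad \Gamma^y=C_1x,\qquad \Gamma^z=z(x),$$ where $z(x)$ must be a solution of the nonlinear ODE $$-\frac{z'(x)}{\sqrt{1+C_1^2+z'(x)^2}}=\frac12(1+C_1^2)(x^2+2C_2),$$ with $C_1,C_2$ constants. For rotation around the $z$-axis, switch the values of $\Gamma^z$ and $\Gamma^y$. This gives a two-parameter family of solutions for rotations of this type. (2) Rotation around the $x$-axis. The components of the curve are $$\Gamma^x=x,\qquad \Gamma^y=\lambda z(x),\qquad \Gamma^z=z(x),$$ where $\lambda\in\mathbb{R}$ and $z(x)$ solves the ODE $$z'(x)=\pm\sqrt{\frac{4-(1+\lambda^2)^2(z^2+2C_1)^2}{(1+\lambda^2)^3(z^2+2C_1)^2}},$$ with $C_1$ a constant. This gives a three-parameter family of solutions for rotation around the $x$-axis.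
   Context: The Vortex Filament Equation is $\partial_t\gamma=\partial_s\gamma\times\partial_{ss}\gamma$, where $s$ is arclength. A rotating self-similar solution with profile curve $\Gamma$ is a solution of the form $\gamma(x,t)=e^{tM}\Gamma(x)$, where $$M=\begin{pmatrix}0&-\omega_y&\omega_z\\ \omega_y&0&-\omega_x\\ -\omega_z&\omega_x&0\end{pmatrix}$$ is a skew-symmetric matrix whose entries are scalars representing the angular velocities of the rotation about each axis. Rotation around a single axis means that only the angular velocity labelled by that axis in $M$ is nonzero (for example, rotation around the $y$-axis means $\omega_x=\omega_z=0$).
   Formalization: Angular velocity w≠0 enters the ODEs as w·x², w·z² (printed: w=1). Case (2): the squared ODE gives rotation w or −w; curves with z≡0 and y solving the ODE (λ=0) are added; non-rotating ODE solutions, constant on a subinterval but not identically zero, are excluded. *)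

(* Defs.v *)
From HB Require Import structures.
From mathcomp Require Import all_boot all_order all_algebra.
From mathcomp Require Import all_classical all_reals all_analysis.

Set Implicit Arguments.
Unset Strict Implicit.
Unset Printing Implicit Defensive.

Import Order.TTheory GRing.Theory Num.Theory.
Import numFieldNormedType.Exports.

Local Open Scope classical_set_scope.
Local Open Scope ring_scope.

Definition col3 (R : realType) (a b c : R) : 'cV[R]_3 :=
  \col_(i < 3) [:: a; b; c]`_i.

(* The library norm on matrices is the sup norm; arclength needs this one. *)
Definition eucl_norm (R : realType) (v : 'cV[R]_3) : R :=
  Num.sqrt (\sum_(i < 3) v i 0 ^+ 2).

Definition cross (R : realType) (u v : 'cV[R]_3) : 'cV[R]_3 :=
  let u1 := u 0 0 in let u2 := u 1 0 in let u3 := u 2%:R 0 in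
  let v1 := v 0 0 in let v2 := v 1 0 in let v3 := v 2%:R 0 in
  col3 (u2 * v3 - u3 * v2) (u3 * v1 - u1 * v3) (u1 * v2 - u2 * v1).

Definition expmx (R : realType) (n : nat) (A : 'M[R]_n.+1) : 'M[R]_n.+1 :=
  limn (series (fun k : nat => k`!%:R^-1 *: A ^+ k)).

(* Beware of the labels: [wy] is the rate of rotation in the (x,y)-plane and
   [wz] the one in the (z,x)-plane, the reverse of the usual labelling. *)
Definition angmx (R : realType) (wx wy wz : R) : 'M[R]_3 :=
  \matrix_(i < 3, j < 3)
    (nth [::] [:: [:: 0; - wy; wz]; [:: wy; 0; - wx]; [:: - wz; wx; 0]] i)`_j.

(* Derivative of [f] with respect to the arclength of the curve [c], both being
   given as functions of the same parameter [x]: ds = |c'(x)| dx. *)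
Definition arc_derive (R : realType) (c f : R -> 'cV[R]_3) (x : R) : 'cV[R]_3 :=
  (eucl_norm (derive1 c x))^-1 *: derive1 f x.

(* [g x t]: position at time [t] of the point of parameter [x].  Derivatives
   are total functions here, hence the explicit derivability clauses. *)
Definition vortex_filament (R : realType) (I : set R)
    (g : R -> R -> 'cV[R]_3) : Prop :=
  forall x t : R, I x ->
    let c := g^~ t in
    [/\ derivable (g x) t 1, derivable c x 1, derivable (derive1 c) x 1,
        derive1 c x != 0 &
        derive1 (g x) t
          = cross (arc_derive c c x) (arc_derive c (arc_derive c c) x)].

Definition profile (R : realType) (y z : R -> R) (x : R) : 'cV[R]_3 :=
  col3 x (y x) (z x).

Definition rotating (R : realType) (I : set R) (wx wy wz : R) (y z : R -> R)
  : Prop :=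
  vortex_filament I
    (fun x t => expmx (t *: angmx wx wy wz) *m profile y z x).

Definition open_interval (R : realType) (I : set R) : Prop :=
  [/\ open I, is_interval I & I !=set0].

(* Angular velocity [w = 1] is the normalization (obtained by rescaling time and
   space) under which one usually writes this equation. *)
Definition ode_transverse (R : realType) (w C1 C2 : R) (I : set R) (f : R -> R)
  : Prop :=
  forall x : R, I x -> derivable f x 1 /\
    - (derive1 f x / Num.sqrt (1 + C1 ^+ 2 + derive1 f x ^+ 2))
      = 2^-1 * (1 + C1 ^+ 2) * (w * x ^+ 2 + 2 * C2).

Definition slope2_axial (R : realType) (w l C1 u : R) : R :=
  (4 - (1 + l ^+ 2) ^+ 2 * (w * u ^+ 2 + 2 * C1) ^+ 2)
  / ((1 + l ^+ 2) ^+ 3 * (w * u ^+ 2 + 2 * C1) ^+ 2).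

(* Division by 0 and square roots of negative numbers are total, so the two
   middle clauses say that the right-hand side is meaningful.  The sign is
   chosen point by point, as it changes where [f] turns back. *)
Definition ode_axial (R : realType) (w l C1 : R) (I : set R) (f : R -> R)
  : Prop :=
  forall x : R, I x ->
    [/\ derivable f x 1, w * f x ^+ 2 + 2 * C1 != 0,
        0 <= slope2_axial w l C1 (f x) &
        derive1 f x = Num.sqrt (slope2_axial w l C1 (f x)) \/
        derive1 f x = - Num.sqrt (slope2_axial w l C1 (f x))].

Definition nowhere_constant (R : realType) (I : set R) (f : R -> R) : Prop :=
  forall a b : R, a < b -> [set` `[a, b]] `<=` I ->
    exists u v : R, [/\ u \in `[a, b], v \in `[a, b] & f u != f v].

(* [ode_axial] also has the spurious solutions that rest at a nonzero constant
   where its right-hand side vanishes (possibly only for some time); such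
   pieces are segments parallel to the axis, which do not rotate by the flow. *)
Definition genuine (R : realType) (I : set R) (f : R -> R) : Prop :=
  (forall x, I x -> f x = 0) \/ nowhere_constant I f.

(* Main.v *)
Require Import Defs.
From HB Require Import structures.
From mathcomp Require Import all_boot all_order all_algebra.
From mathcomp Require Import all_classical all_reals all_analysis.
From mathcomp Require Import ring lra.

(** A rotation [e^(tM)] commutes with the cross product and preserves arclength.
    Hence the curves [e^(tM) Gamma] solve the vortex filament equation at all times as
    soon as they solve it at time 0, where the equation says
    [Gamma' x Gamma'' = |Gamma'|^3 (omega x Gamma)] with [M v = omega x v]
    ([rotatingP]).  The exponential is explicit because [M^3 = - |omega|^2 M], which is
    the formula of Rodrigues ([expmx_cube]).  For [Gamma = (x, y, z)] this makes three
    scalar equations ([profile_equationE]).  The exchange of [y] and [z] turns rotation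
    about the y-axis into rotation about the z-axis, so that these need one proof.

    About the y-axis the equations give [y'' = 0], then [y = C1 x], then
    [z'' = - w x |Gamma'|^3].  Up to the factor [1 + C1^2], [z'' / |Gamma'|^3] is the
    derivative of the sine [z' / |Gamma'|] of the slope, so one integration gives the
    equation [ode_transverse].  Conversely that equation determines [z'] as a smooth function
    of [x], and can be differentiated ([transverseP]).

    About the x-axis, [y] and [z] solve the same linear equation
    [h'' = e |Gamma'|^3 h] with vanishing Wronskian, so they are proportional.  There
    remains [f'' = e N^3 f] with [N = sqrt (1 + k f'^2)] and [k = 1 + l^2] ([bending]),
    which has the first integral [1 / N + k e f^2 / 2].  Squaring it gives [ode_axial],
    in the form [Q^2 N^2 = 4] with [Q = k (w f^2 + 2 C)] ([ode_axialP]); the sign of [Q]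
    lost by squaring is the sense of rotation, [e = w] or [e = - w].

    The converse is the delicate part ([axial_second]): a solution [f] of [ode_axial] is
    only assumed differentiable, and [f'^2 = S (f)] says nothing on [f''] where [f']
    vanishes.  Away from these points [f'] has locally a constant sign, and differentiating
    gives [f'' = G (f)] with [G] smooth.  At a critical point on the axis, [S (f)] is a
    multiple of [f^2] and Gronwall forces [f = 0] everywhere.  At any other critical
    point, neighbouring critical points would take the same value of [f], and Rolle's
    argument would make [f] constant between them; so the point is isolated and
    [f'' = G (f)] extends to it by continuity.  This is where the segments parallel to
    the axis have to be excluded.

    In the families, existence follows from separation of variables, and a genuine
    solution of [ode_axial] is determined by [f x0] and [f' x0] because [G (f) - G (g)] is
    a continuous multiple of [f - g], so that [f - g] solves a linear equation
    ([axial_unique]). *)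

Set Implicit Arguments.
Unset Strict Implicit.
Unset Printing Implicit Defensive.

Import Order.TTheory GRing.Theory Num.Theory.
Import numFieldNormedType.Exports.

Local Open Scope classical_set_scope.
Local Open Scope ring_scope.

(** * Calculus on an interval *)

Lemma add1_sqr_gt0 (R : realType) (l : R) : 0 < 1 + l ^+ 2.
Proof. by rewrite ltr_wpDr// sqr_ge0. Qed.

Lemma is_derive1E (R : realType) (f : R -> R) (x d : R) :
  is_derive x 1 f d <-> derivable f x 1 /\ derive1 f x = d.
Proof.
split=> [[df <-]|[df <-]]; first by rewrite derive1E.
by apply: DeriveDef => //; rewrite derive1E.
Qed.

Lemma is_derive_sqr (R : realType) (f : R -> R) (x d : R) :
  is_derive x 1 f d -> is_derive x 1 (fun t => f t ^+ 2) (2 * f x * d).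
Proof.
move=> df; have : is_derive x 1 (f ^+ 2) (2 * f x * d).
  by apply: is_derive_eq; rewrite /GRing.scale/= expr1; ring.
by apply: near_eq_is_derive; near=> t; rewrite exprfctE.
Unshelve. all: by end_near. Qed.

(** Rules of differentiation for functions written pointwise; with explicit derivatives
    they can be composed into terms. *)
Section PointwiseDerivatives.
Variables (R : realType) (x : R).
Implicit Types (f g : R -> R) (k a b : R).

Lemma is_derive_funD f g a b : is_derive x 1 f a -> is_derive x 1 g b ->
  is_derive x 1 (fun t => f t + g t) (a + b).
Proof. by move=> df dg; exact: (is_deriveD df dg). Qed.

Lemma is_derive_funB f g a b : is_derive x 1 f a -> is_derive x 1 g b ->
  is_derive x 1 (fun t => f t - g t) (a - b).
Proof. by move=> df dg; exact: (is_deriveB df dg). Qed.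

Lemma is_derive_funM f g a b : is_derive x 1 f a -> is_derive x 1 g b ->
  is_derive x 1 (fun t => f t * g t) (f x * b + a * g x).
Proof. by move=> df dg; apply: (is_derive_eq (is_deriveM df dg)); rewrite [a * _]mulrC. Qed.

Lemma is_derive_const k : is_derive x 1 (fun=> k) 0.
Proof. exact: (is_derive_cst k x (1 : R)). Qed.

Lemma is_derive_funZ k f a : is_derive x 1 f a ->
  is_derive x 1 (fun t => k * f t) (k * a).
Proof. by move=> df; exact: (is_deriveZ k df). Qed.

Lemma is_derive_funZr k f a : is_derive x 1 f a ->
  is_derive x 1 (fun t => f t * k) (a * k).
Proof.
move=> df; under eq_fun do rewrite mulrC; rewrite mulrC; exact: is_derive_funZ.
Qed.

Lemma is_derive_funV f a : is_derive x 1 f a -> f x != 0 ->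
  is_derive x 1 (fun t => (f t)^-1) (- a / f x ^+ 2).
Proof.
move=> df fx0; apply: (is_derive_eq (is_deriveV fx0 df)).
by rewrite /GRing.scale/= !mulNr mulrC.
Qed.

Lemma is_derive_fun_comp f g a b : is_derive x 1 g b -> is_derive (g x) 1 f a ->
  is_derive x 1 (fun t => f (g t)) (a * b).
Proof. by move=> dg df; exact: (is_derive1_comp df dg). Qed.

Lemma is_derive_fun_sqrt f a : is_derive x 1 f a -> 0 < f x ->
  is_derive x 1 (fun t => Num.sqrt (f t)) (a / (2 * Num.sqrt (f x))).
Proof.
move=> df fx0; rewrite mulrC.
exact: (is_derive_fun_comp df (is_derive1_sqrt fx0)).
Qed.

End PointwiseDerivatives.

Lemma is_derive_continuous (R : realType) (f : R -> R) (x d : R) :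
  is_derive x 1 f d -> {for x, continuous f}.
Proof.
by case=> df _; apply/differentiable_continuous/derivable1_diffP.
Qed.

Lemma is_derive_within (R : realType) (f f' : R -> R) (a b : R) :
  (forall x, a <= x <= b -> is_derive x 1 f (f' x)) ->
  {within `[a, b], continuous f}.
Proof.
move=> df; apply: derivable_within_continuous => x; rewrite in_itv/= => /df.
by case.
Qed.

Lemma nonincreasing_of_is_derive (R : realType) (f f' : R -> R) (a b : R) :
  a <= b -> (forall x, a <= x <= b -> is_derive x 1 f (f' x)) ->
  (forall x, a <= x <= b -> f' x <= 0) -> f b <= f a.
Proof.
move=> ab df f'0.
have [|c] := @MVT_segment _ f f' a b ab _ (is_derive_within df).
  by move=> x; rewrite in_itv/= => /andP[/ltW ax /ltW xb]; apply: df; rewrite ax.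
rewrite in_itv/= => cab E; rewrite -subr_le0 E.
by rewrite mulr_le0_ge0 ?f'0// subr_ge0.
Qed.

Lemma constant_of_is_derive0 (R : realType) (I : set R) (f : R -> R) :
  is_interval I -> (forall x, I x -> is_derive x 1 f 0) ->
  forall x y, I x -> I y -> f x = f y.
Proof.
move=> iI df x y; wlog xy : x y / x <= y => [hw Ix Iy|Ix Iy].
  by case/orP: (le_total x y) => xy; [|symmetry]; apply: hw.
have dfI z : x <= z <= y -> is_derive z 1 f 0 by move=> /(iI _ _ Ix Iy)/df.
have [|c] := @MVT_segment _ f (fun=> 0) x y xy _ (is_derive_within dfI).
  by move=> z; rewrite in_itv/= => /andP[/ltW ax /ltW xb]; apply: dfI; rewrite ax.
by rewrite mul0r => _ /eqP; rewrite subr_eq0 => /eqP.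
Qed.

Lemma continuous_seg_bounded (R : realType) (p : R -> R) (a b : R) :
  a <= b -> (forall x, a <= x <= b -> {for x, continuous p}) ->
  exists K, forall x, a <= x <= b -> p x <= K.
Proof.
move=> ab cp; have [|c cab h] := @EVT_max _ p a b ab.
  apply: continuous_in_subspaceT => x; rewrite inE/= in_itv/=; exact: cp.
by exists (p c) => x xab; apply: h; rewrite in_itv.
Qed.

(** If [p <= K] between [x0] and [x], then [E t * expR (- K * t)] is nonincreasing there, and
    [E t * expR (K * t)] nondecreasing; one or the other is used according to the side of
    [x0] on which [x] lies. *)
Lemma gronwall (R : realType) (I : set R) (E E' p : R -> R) (x0 : R) :
  is_interval I -> (forall x, I x -> is_derive x 1 E (E' x)) ->
  (forall x, I x -> {for x, continuous p}) ->
  (forall x, I x -> 0 <= E x) -> (forall x, I x -> `|E' x| <= p x * E x) ->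
  I x0 -> E x0 = 0 -> forall x, I x -> E x = 0.
Proof.
move=> iI dE cp E0 leE Ix0 Ex0 x Ix.
have dphi (K t : R) : I t -> is_derive t 1 (fun s => E s * expR (K * s))
    (expR (K * t) * (E' t + K * E t)).
  move=> It; have dEt := dE t It; apply: is_derive_eq.
  by rewrite !scaler1 /GRing.scale/=; ring.
have pos (K t : R) : 0 < expR (K * t) by exact: expR_gt0.
apply/eqP; rewrite eq_le E0// andbT.
case/orP: (le_total x0 x) => xx.
- have sI t : x0 <= t <= x -> I t by exact: (iI _ _ Ix0 Ix).
  have [|K pK] := @continuous_seg_bounded _ p x0 x xx.
    by move=> t /sI/cp.
  have := @nonincreasing_of_is_derive _ (fun s => E s * expR (- K * s)) _ _ _ xx
    (fun t ht => dphi (- K) t (sI t ht)).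
  rewrite Ex0 mul0r pmulr_lle0//; apply=> t tx.
  rewrite pmulr_rle0//; have := leE t (sI t tx); have := pK t tx.
  have := E0 t (sI t tx); rewrite ler_norml; nra.
- have sI t : x <= t <= x0 -> I t by exact: (iI _ _ Ix Ix0).
  have [|K pK] := @continuous_seg_bounded _ p x x0 xx.
    by move=> t /sI/cp.
  have := @nonincreasing_of_is_derive _ (fun s => - (E s * expR (K * s)))
     (fun t => - (expR (K * t) * (E' t + K * E t))) _ _ xx.
  rewrite Ex0 mul0r oppr0 oppr_ge0 pmulr_lle0//; apply=> t tx.
    by have := dphi K t (sI t tx) => ?; apply: is_deriveN.
  rewrite oppr_le0 pmulr_rge0//; have := leE t (sI t tx); have := pK t tx.
  have := E0 t (sI t tx); rewrite ler_norml; nra.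
Qed.

(** Gronwall applied to [h ^+ 2 + h1 ^+ 2], as
    [|2 h h1 (1 + p)| <= (1 + |p|) (h ^+ 2 + h1 ^+ 2)]. *)
Lemma linear_ode2_unique (R : realType) (I : set R) (h h1 p : R -> R) (x0 : R) :
  is_interval I -> (forall x, I x -> is_derive x 1 h (h1 x)) ->
  (forall x, I x -> is_derive x 1 h1 (p x * h x)) ->
  (forall x, I x -> {for x, continuous p}) ->
  I x0 -> h x0 = 0 -> h1 x0 = 0 -> forall x, I x -> h x = 0.
Proof.
move=> iI dh dh1 cp Ix0 hx0 h1x0 x Ix.
suff : h x ^+ 2 + h1 x ^+ 2 = 0.
  by move/eqP; rewrite paddr_eq0 ?sqr_ge0// sqrf_eq0 => /andP[/eqP].
apply: (@gronwall _ I (fun x => h x ^+ 2 + h1 x ^+ 2)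
  (fun x => 2 * h x * h1 x * (1 + p x)) (fun x => 1 + `|p x|) x0) => //.
- move=> t It; have dht := dh t It; have dh1t := dh1 t It.
  by apply: (is_derive_eq (is_derive_funD (is_derive_sqr dht) (is_derive_sqr dh1t))); ring.
- move=> t It; apply: cvgD; first exact: cvg_cst.
  exact: cvg_norm (cp _ It).
- by move=> t It; rewrite addr_ge0 ?sqr_ge0.
- move=> t It; rewrite normrM mulrC ler_pM ?normr_ge0//.
    by rewrite (le_trans (ler_normD _ _))// normr1.
  have := sqr_ge0 (h t - h1 t); have := sqr_ge0 (h t + h1 t).
  by rewrite ler_norml => ? ?; apply/andP; split; nra.
- by rewrite hx0 h1x0 expr0n addr0.
Qed.

Lemma is_derive_derive1 (R : realType) (V : normedModType R) (f : R -> V) (x : R) :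
  derivable f x 1 -> is_derive x 1 f (derive1 f x).
Proof. by move=> df; rewrite derive1E; exact: derivableP. Qed.

Lemma derive1_val (R : realType) (V : normedModType R) (f : R -> V) (x : R) (d : V) :
  is_derive x 1 f d -> derive1 f x = d.
Proof. by move=> df; rewrite derive1E derive_val. Qed.

Lemma is_derive_open (R : realType) (I : set R) (f g : R -> R) (x d : R) : open I -> I x ->
  (forall t, I t -> f t = g t) -> is_derive x 1 f d -> is_derive x 1 g d.
Proof.
move=> oI Ix fg; apply: near_eq_is_derive.
have nI : \forall t \near x, I t by exact: open_nbhs_nbhs.
by near=> t; apply: fg; near: t.
Unshelve. all: by end_near. Qed.

Lemma injective_of_derive_neq0 (R : realType) (f f' : R -> R) (a b : R) :
  (forall x, a < x < b -> is_derive x 1 f (f' x)) ->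
  (forall x, a < x < b -> f' x != 0) ->
  forall x y, a < x < b -> a < y < b -> f x = f y -> x = y.
Proof.
move=> df f'0 x y; wlog xy : x y / x < y => [hw xI yI e|xI yI e].
  have [xy|yx|//] := ltgtP x y; first exact: hw.
  by symmetry; apply: hw.
have sI c : x <= c <= y -> a < c < b.
  move: xI yI => /andP[ax _] /andP[_ yb] /andP[xc cy].
  by rewrite (lt_le_trans ax xc) (le_lt_trans cy yb).
have [|c] := @MVT _ f f' x y xy _ (is_derive_within (fun c hc => df c (sI c hc))).
  move=> c; rewrite in_itv/= => /andP[/ltW xc /ltW cy].
  by apply: df; apply: sI; rewrite xc.
rewrite in_itv/= => /andP[/ltW xc /ltW cy] /esym/eqP; rewrite e subrr.
suff : f' c * (y - x) != 0 by move=> /negPf ->.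
by rewrite mulf_neq0 ?subr_eq0 ?(gt_eqF xy)// f'0// sI// xc.
Qed.

(** Darboux's theorem for a nonvanishing derivative: [f] is injective by Rolle, hence strictly
    monotone. *)
Lemma derive_constant_sign (R : realType) (f f' : R -> R) (a b : R) :
  (forall x, a < x < b -> is_derive x 1 f (f' x)) ->
  (forall x, a < x < b -> f' x != 0) ->
  (forall x, a < x < b -> 0 < f' x) \/ (forall x, a < x < b -> f' x < 0).
Proof.
move=> df f'0.
have der : {in `]a, b[, forall x, derivable f x 1}.
  by move=> x; rewrite in_itv/= => /df[].
have cf : {within `]a, b[, continuous f}.
  by apply: derivable_within_continuous => x; exact: der.
have inj : {in `]a, b[ &, injective f}.
  by move=> x y; rewrite !in_itv/=; exact: (injective_of_derive_neq0 df f'0).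
have f'E x : a < x < b -> f' x = derive1 f x.
  by move=> /df /is_derive1E[_ ->].
have [inc|dec] := itv_continuous_inj_mono cf inj.
- left=> x xab; rewrite lt_def f'0//= f'E//.
  apply: (incr_derive1_ge0_itv _ inc); last by rewrite in_itv.
  by move=> y; rewrite inE; exact: der.
- right=> x xab; rewrite lt_def eq_sym f'0//= f'E//.
  apply: (decr_derive1_le0_itv _ dec); last by rewrite in_itv.
  by move=> y; rewrite inE; exact: der.
Qed.

(** By the mean value theorem, the growth rates of [g] at [x0] are values of [h] at points
    that tend to [x0]. *)
Lemma is_derive_extend (R : realType) (g h : R -> R) (x0 r : R) : 0 < r ->
  (forall x, `|x0 - x| < r -> x != x0 -> is_derive x 1 g (h x)) ->
  {for x0, continuous g} -> {for x0, continuous h} -> is_derive x0 1 g (h x0).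
Proof.
move=> r0 dg cg ch; apply/is_derive1_caratheodory.
exists (fun z => if z == x0 then h x0 else (g z - g x0) / (z - x0)); split.
- move=> z; case: eqVneq => [->|zx]; first by rewrite !subrr mulr0.
  by rewrite divfK// subr_eq0.
- apply/cvgrPdist_lt => e e0; rewrite eqxx.
  move/cvgrPdist_lt : ch => /(_ e e0) /nbhs_ballP[d /= d0 hd].
  apply/nbhs_ballP; exists (Num.min d r) => /=; first by rewrite lt_min d0.
  move=> z; rewrite /ball/= lt_min => /andP[zd zr].
  case: eqVneq => [_|zx]; first by rewrite subrr normr0.
  have [c [cd ->]] : exists c, `|x0 - c| <= `|x0 - z| /\ (g z - g x0) / (z - x0) = h c.
    have cont a b : `|x0 - a| <= `|x0 - z| -> `|x0 - b| <= `|x0 - z| -> a <= b ->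
        {within `[a, b], continuous g}.
      move=> ha hb ab; apply: continuous_in_subspaceT => c.
      rewrite inE/= in_itv/= => /andP[ac cb].
      have [->|cx] := eqVneq c x0; first exact: cg.
      apply: (is_derive_continuous (dg c _ cx)); apply: le_lt_trans zr.
      by move: ha hb; rewrite !ler_norml => /andP[? ?] /andP[? ?]; apply/andP; split; lra.
    have [xz|xz] := ltP x0 z.
      have [||c cI e1] := @MVT _ g h x0 z xz.
      - move=> c; rewrite in_itv/= => /andP[xc cz]; apply: dg; last by rewrite gt_eqF.
        apply: lt_trans zr; rewrite !ltr0_norm ?subr_lt0//; lra.
      - by apply: cont; rewrite ?subrr ?normr0// ltW.
      exists c; split; last by rewrite e1 mulfK// subr_eq0.
      move: cI; rewrite in_itv/= => /andP[xc cz].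
      rewrite !ltr0_norm ?subr_lt0//; lra.
    have {}xz : z < x0 by rewrite lt_neqAle zx.
    have [||c cI e1] := @MVT _ g h z x0 xz.
    - move=> c; rewrite in_itv/= => /andP[zc cx]; apply: dg; last by rewrite lt_eqF.
      apply: lt_trans zr; rewrite !gtr0_norm ?subr_gt0//; lra.
    - by apply: cont; rewrite ?subrr ?normr0// ltW.
    exists c; split; last by rewrite -opprB e1 -(opprB x0) invrN mulrNN mulfK// subr_eq0 eq_sym.
    move: cI; rewrite in_itv/= => /andP[zc cx].
    rewrite !gtr0_norm ?subr_gt0//; lra.
  by apply: hd; rewrite /ball/=; exact: le_lt_trans zd.
- by rewrite eqxx.
Qed.

Lemma continuous_constant_sign (R : realType) (I : set R) (q : R -> R) :
  is_interval I -> (forall x, I x -> {for x, continuous q}) ->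
  (forall x, I x -> q x != 0) ->
  (forall x, I x -> 0 < q x) \/ (forall x, I x -> q x < 0).
Proof.
move=> iI cq q0.
suff same x y : I x -> I y -> 0 < q x -> 0 < q y.
  have [[x Ix qx]|no] := pselect (exists2 x, I x & 0 < q x); [left|right] => y Iy.
    exact: same qx.
  rewrite lt_neqAle q0//= leNgt; apply/negP => qy; apply: no.
  by exists y.
move=> Ix Iy qx; rewrite ltNge; apply/negP => qy.
have cI a b : I a -> I b -> {within `[a, b], continuous q}.
  move=> Ia Ib; apply: continuous_in_subspaceT => c; rewrite inE/= in_itv/= => ab.
  exact/cq/(iI a b Ia Ib).
have [xy|/ltW yx] := leP x y.
  have [|c] := IVT xy (cI x y Ix Iy) (v := 0).
    by rewrite ge_min qy orbT le_max (ltW qx).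
  by rewrite in_itv/= => cxy /eqP; rewrite (negPf (q0 _ _))//; exact: (iI _ _ Ix Iy).
have [|c] := IVT yx (cI y x Iy Ix) (v := 0).
  by rewrite ge_min qy le_max (ltW qx) orbT.
by rewrite in_itv/= => cxy /eqP; rewrite (negPf (q0 _ _))//; exact: (iI _ _ Iy Ix).
Qed.

Section OpenIntervals.
Variable R : realType.
Implicit Types I : set R.

Lemma open_interval_point_neq0 I : open_interval I -> exists2 x, I x & x != 0.
Proof.
move=> [oI _ [x0 Ix0]]; have [e|x00] := eqVneq x0 0; last by exists x0.
have : nbhs x0 I by exact: open_nbhs_nbhs.
move=> /nbhs_ballP[r /= r0 hr]; exists (r / 2); last by rewrite lt0r_neq0// divr_gt0.
by apply: hr; rewrite /ball/= e sub0r normrN gtr0_norm; lra.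
Qed.

Lemma open_interval_segment I : open_interval I ->
  exists a b, a < b /\ [set` `[a, b]] `<=` I.
Proof.
move=> [oI iI [x0 Ix0]]; have : nbhs x0 I by exact: open_nbhs_nbhs.
move=> /nbhs_ballP[r /= r0 hr].
exists x0, (x0 + r / 2); split; first by rewrite ltrDl divr_gt0.
move=> c /=; rewrite in_itv/= => /andP[xc cx]; apply: hr; rewrite /ball/=.
by rewrite ler0_norm ?subr_le0//; lra.
Qed.

Lemma open_interval_around (x r : R) : 0 < r ->
  open_interval [set t | x - r < t < x + r] /\ x - r < x < x + r.
Proof.
move=> r0; have xr : x - r < x < x + r by rewrite ltrBlDr ltrDl r0.
split=> //; split.
- by have := @interval_open R (BRight (x - r)) (BLeft (x + r)) isT isT; rewrite set_itvoo.
- move=> a b /andP[xa _] /andP[_ br] c /andP[ac cb].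
  by rewrite /= (lt_le_trans xa ac) (le_lt_trans cb br).
- by exists x.
Qed.

End OpenIntervals.

(** * Rotations and their exponentials *)

Section Rodrigues.
Variables (R : realType) (n : nat) (A : 'M[R]_n.+1) (th : R).
Hypotheses (th0 : th != 0) (A3 : A ^+ 3 = - th ^+ 2 *: A).

Lemma expr_odd_cube m : A ^+ m.*2.+1 = (- th ^+ 2) ^+ m *: A.
Proof.
elim: m => [|m IH]; first by rewrite expr1 expr0 scale1r.
by rewrite doubleS -addn2 exprD IH -scalerAl -exprS A3 scalerA -exprSr.
Qed.

(** As [A ^+ 3] is a multiple of [A], the odd and even powers of [A] are multiples of [A] and
    [A ^+ 2], and the exponential splits into a sine and a cosine series. *)
Lemma exp_term t k : (k > 0)%N ->
  k`!%:R^-1 *: (t *: A) ^+ k =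
  (sin_coeff (t * th) k / th) *: A - (cos_coeff (t * th) k / th ^+ 2) *: A ^+ 2.
Proof.
move=> k0; rewrite exprZn scalerA.
have := odd_double_half k; case: (boolP (odd k)) => ok; rewrite ?add1n ?add0n.
  move=> <-; set m := k./2; rewrite expr_odd_cube cos_coeff_odd mul0r scale0r subr0.
  rewrite scalerA -sin_coeff'E /sin_coeff'; congr (_ *: _).
  have : m.*2.+1`!%:R != 0 :> R by rewrite pnatr_eq0 -lt0n fact_gt0.
  move: (m.*2.+1`!%:R) => c c0.
  rewrite exprNn -exprM mul2n !exprMn -exprnP !exprS; field.
  by rewrite th0.
case: k k0 ok => // k _ ok; case E : (k.+1)./2 => [|m] // <-.
rewrite -cos_coeff'E sin_coeff_even mul0r scale0r sub0r -scaleNr /cos_coeff'.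
have -> : A ^+ m.+1.*2 = (- th ^+ 2) ^+ m *: A ^+ 2.
  by rewrite doubleS exprS expr_odd_cube -scalerAr -expr2.
rewrite scalerA; congr (_ *: _).
have : m.+1.*2`!%:R != 0 :> R by rewrite pnatr_eq0 -lt0n fact_gt0.
move: (m.+1.*2`!%:R) => c c0.
rewrite exprNn -exprM mul2n !exprMn -exprnP doubleS !exprS; field.
by rewrite th0.
Qed.

(** The formula of Rodrigues. *)
Lemma expmx_cube t : expmx (t *: A) =
  1 + (sin (t * th) / th) *: A + ((1 - cos (t * th)) / th ^+ 2) *: A ^+ 2.
Proof.
apply: cvg_lim => //.
(* the term of index 0 is the only one that [exp_term] does not describe *)
rewrite -(cvg_shiftS _).
have -> : (fun k => series (fun k : nat => k`!%:R^-1 *: (t *: A) ^+ k) k.+1) =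
  (fun k => 1 + (series (sin_coeff (t * th)) k.+1 / th) *: A +
     ((1 - series (cos_coeff (t * th)) k.+1) / th ^+ 2) *: A ^+ 2).
  apply/funext; elim=> [|k IH].
    rewrite /series/= !big_nat1 fact0 expr0 invr1 scale1r /sin_coeff /cos_coeff/=.
    by rewrite fact0 expr0 expr0z !mul0r scale0r invr1 !mulr1 subrr mul0r scale0r !addr0.
  rewrite seriesSr IH exp_term//.
  rewrite (@seriesSr _ (sin_coeff _) k.+1) (@seriesSr _ (cos_coeff _) k.+1).
  rewrite [in RHS](mulrDl (series _ _)) [in RHS]scalerDl opprD (addrA 1 (- _) (- _)).
  rewrite [in RHS](mulrDl (1 - _)) mulNr [in RHS]scalerDl scaleNr addrACA.
  by rewrite -(addrA 1).
apply: cvgD; first apply: cvgD; first exact: cvg_cst.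
  apply: cvgZr_tmp; apply: cvgMr_tmp.
  have -> : sin (t * th) = limn (series (sin_coeff (t * th))) by rewrite unlock.
  by rewrite (cvg_shiftS (series _)); exact: is_cvg_series_sin_coeff.
apply: cvgZr_tmp; apply: cvgMr_tmp; apply: cvgB; first exact: cvg_cst.
have -> : cos (t * th) = limn (series (cos_coeff (t * th))) by rewrite unlock.
by rewrite (cvg_shiftS (series _)); exact: is_cvg_series_cos_coeff.
Qed.
End Rodrigues.

Section Vectors.
Variable R : realType.
Implicit Types (u v w : 'cV[R]_3) (a b c : R).

Lemma col3E a b c : (col3 a b c 0 0 = a) * (col3 a b c 1 0 = b) *
  (col3 a b c 2%:R 0 = c).
Proof. by rewrite !mxE. Qed.

Lemma col3P u v :
  u 0 0 = v 0 0 -> u 1 0 = v 1 0 -> u 2%:R 0 = v 2%:R 0 -> u = v.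
Proof.
move=> h0 h1 h2; apply/matrixP => i j; rewrite (ord1 j).
case: i => -[|[|[|//]]] hi.
- by rewrite (_ : Ordinal hi = 0)//; exact/val_inj.
- by rewrite (_ : Ordinal hi = 1)//; exact/val_inj.
- by rewrite (_ : Ordinal hi = 2%:R)//; exact/val_inj.
Qed.

Lemma eucl_normE u : eucl_norm u =
  Num.sqrt (u 0 0 ^+ 2 + u 1 0 ^+ 2 + u 2%:R 0 ^+ 2).
Proof.
rewrite /eucl_norm !big_ord_recl big_ord0 addr0 addrA.
by congr (Num.sqrt (_ + u _ _ ^+ 2 + u _ _ ^+ 2)); exact/val_inj.
Qed.

(** The axis is [(wx, wz, wy)] because of the order in which [angmx] takes its labels. *)
Lemma angmx_mul (wx wy wz : R) v :
  angmx wx wy wz *m v = cross (col3 wx wz wy) v.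
Proof.
have E (A : 'M[R]_3) i : (A *m v) i 0 =
    A i 0 * v 0 0 + A i 1 * v 1 0 + A i 2%:R * v 2%:R 0.
  rewrite mxE !big_ord_recl big_ord0 addr0 addrA.
  by congr (_ + A _ _ * v _ _ + A _ _ * v _ _); exact/val_inj.
by apply: col3P; rewrite E /cross /angmx !mxE/=; ring.
Qed.

(** [v] turned about the axis [w]; a rotation as soon as
    [2 * b = a ^+ 2 + b ^+ 2 * |w|^2]. *)
Definition turn w a b v : 'cV[R]_3 := v + a *: cross w v + b *: cross w (cross w v).

(** [|turn v|^2 - |v|^2] is [a ^+ 2 + b ^+ 2 * |w|^2 - 2 * b] times [|w x v|^2]. *)
Lemma norm_turn w a b v :
  2 * b = a ^+ 2 + b ^+ 2 * (w 0 0 ^+ 2 + w 1 0 ^+ 2 + w 2%:R 0 ^+ 2) ->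
  eucl_norm (turn w a b v) = eucl_norm v.
Proof.
set q := (X in _ + _ * X) => hab; rewrite !eucl_normE; congr Num.sqrt.
apply/eqP; rewrite -subr_eq0.
set k := cross w v; have hk : a ^+ 2 + b ^+ 2 * q - 2 * b = 0 by rewrite hab subrr.
rewrite [X in X == _](_ : _ = (a ^+ 2 + b ^+ 2 * q - 2 * b) *
  (k 0 0 ^+ 2 + k 1 0 ^+ 2 + k 2%:R 0 ^+ 2)); first by rewrite hk mul0r.
by rewrite /q /k /turn /cross !(col3E, mxE)/=; ring.
Qed.

(** The two sides differ by a multiple of [w], of factor
    [a ^+ 2 + b ^+ 2 * |w|^2 - 2 * b] times [w . (u x v)]: this comes from
    [(w x u) x (w x v) = (w . (u x v)) w]. *)
Lemma cross_turn w a b u v :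
  2 * b = a ^+ 2 + b ^+ 2 * (w 0 0 ^+ 2 + w 1 0 ^+ 2 + w 2%:R 0 ^+ 2) ->
  cross (turn w a b u) (turn w a b v) = turn w a b (cross u v).
Proof.
set q := (X in _ + _ * X) => hab.
have hk : a ^+ 2 + b ^+ 2 * q - 2 * b = 0 by rewrite hab subrr.
pose k := cross u v; pose p := w 0 0 * k 0 0 + w 1 0 * k 1 0 + w 2%:R 0 * k 2%:R 0.
apply/eqP; rewrite -subr_eq0; apply/eqP.
have -> : 0 = ((a ^+ 2 + b ^+ 2 * q - 2 * b) * p) *: w :> 'cV[R]_3.
  by rewrite hk mul0r scale0r.
by apply: col3P; rewrite /q /p /k /turn /cross !(col3E, mxE)/=; ring.
Qed.

Lemma crossZ a b u v : cross (a *: u) (b *: v) = (a * b) *: cross u v.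
Proof. by apply: col3P; rewrite /cross !(col3E, mxE)/=; ring. Qed.

Lemma cross_comb a b u v : cross u (a *: u + b *: v) = b *: cross u v.
Proof. by apply: col3P; rewrite /cross !(col3E, mxE)/=; ring. Qed.

Lemma angmx_cube (wx wy wz th : R) : th ^+ 2 = wx ^+ 2 + wy ^+ 2 + wz ^+ 2 ->
  angmx wx wy wz ^+ 3 = - th ^+ 2 *: angmx wx wy wz.
Proof.
move=> hth; suff E v : angmx wx wy wz ^+ 3 *m v = (- th ^+ 2 *: angmx wx wy wz) *m v.
  apply/matrixP => i j; have := congr1 (fun u : 'cV[R]_3 => u i 0) (E (delta_mx j 0)).
  by rewrite -!colE ![col _ _ _ _]mxE.
rewrite -scalemxAl exprS -mulmxE -mulmxA angmx_mul expr2 -mulmxE -mulmxA.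
rewrite !angmx_mul hth.
by apply: col3P; rewrite /cross !(col3E, mxE)/=; ring.
Qed.

Lemma expmx_angmx (wx wy wz th t : R) v :
  th != 0 -> th ^+ 2 = wx ^+ 2 + wy ^+ 2 + wz ^+ 2 ->
  expmx (t *: angmx wx wy wz) *m v =
  turn (col3 wx wz wy) (sin (t * th) / th) ((1 - cos (t * th)) / th ^+ 2) v.
Proof.
move=> th0 hth; rewrite (expmx_cube th0 (angmx_cube hth)).
rewrite !mulmxDl -!scalemxAl expr2. rewrite -!mulmxA !angmx_mul.
by rewrite mul1mx.
Qed.

Lemma turn_coef (th x : R) : th != 0 ->
  2 * ((1 - cos x) / th ^+ 2) =
  (sin x / th) ^+ 2 + ((1 - cos x) / th ^+ 2) ^+ 2 * th ^+ 2.
Proof.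
move=> th0; have := cos2Dsin2 x => h.
have -> : (sin x / th) ^+ 2 = (1 - cos x ^+ 2) / th ^+ 2.
  by rewrite -h; field.
by field.
Qed.

End Vectors.

(** * Derivatives of vector-valued functions *)

Section VectorCalculus.
Variable R : realType.

Lemma is_derive_mxP m n (M : R -> 'M[R]_(m, n)) (x : R) (M' : 'M[R]_(m, n)) :
  is_derive x 1 M M' <-> forall i j, is_derive x 1 (fun t => M t i j) (M' i j).
Proof.
split=> [[dM <-] i j|dM].
  split; first by move/derivable_mxP : dM.
  by rewrite derive_mx// mxE.
have dM1 : derivable M x 1 by apply/derivable_mxP => i j; case: (dM i j).
split=> //; rewrite derive_mx//; apply/matrixP => i j; rewrite mxE.
by case: (dM i j).
Qed.

Lemma is_derive_mulmx m n p (P : 'M[R]_(m, n)) (M : R -> 'M[R]_(n, p)) (x : R)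
    (M' : 'M[R]_(n, p)) :
  is_derive x 1 M M' -> is_derive x 1 (fun t => P *m M t) (P *m M').
Proof.
move/is_derive_mxP => dM; apply/is_derive_mxP => i j.
rewrite mxE; under eq_fun do rewrite mxE.
have dk k : is_derive x 1 (fun t => P i k * M t k j) (P i k * M' k j).
  by have := dM k j => dMk; exact: is_deriveZ.
have := is_derive_sum dk.
by apply: near_eq_is_derive; near=> t; rewrite fct_sumE.
Unshelve. all: by end_near. Qed.

Lemma is_derive_col3 (f g h : R -> R) (x f' g' h' : R) :
  is_derive x 1 f f' -> is_derive x 1 g g' -> is_derive x 1 h h' ->
  is_derive x 1 (fun t => col3 (f t) (g t) (h t)) (col3 f' g' h').
Proof.
move=> df dg dh; apply/is_derive_mxP => i j.
rewrite mxE; under eq_fun do rewrite mxE.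
by case: i => -[|[|[|//]]] hi /=.
Qed.

(** [P' = P M] for [P = e^(tM)]: since [w x (w x (w x v)) = - |w|^2 (w x v)], both sides are
    [cos (t * th)] times [w x v] plus [sin (t * th) / th] times [w x (w x v)]. *)
Lemma is_derive_turn (th t : R) (w v : 'cV[R]_3) : th != 0 ->
  th ^+ 2 = w 0 0 ^+ 2 + w 1 0 ^+ 2 + w 2%:R 0 ^+ 2 ->
  is_derive t 1
    (fun s => turn w (sin (s * th) / th) ((1 - cos (s * th)) / th ^+ 2) v)
    (turn w (sin (t * th) / th) ((1 - cos (t * th)) / th ^+ 2) (cross w v)).
Proof.
move=> th0 hth.
have dm : is_derive t 1 (fun s => s * th) th.
  by apply: is_derive_eq; rewrite /GRing.scale/= mulr0 mulr1 add0r.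
have ds : is_derive t 1 (fun s => sin (s * th) / th) (cos (t * th)).
  apply: (is_derive_eq (is_derive_funZr _ (is_derive_fun_comp dm (is_derive_sin _)))).
  by field.
have dc : is_derive t 1 (fun s => (1 - cos (s * th)) / th ^+ 2) (sin (t * th) / th).
  apply: (is_derive_eq (is_derive_funZr _ (is_derive_funB (is_derive_cst _ _ _)
    (is_derive_fun_comp dm (is_derive_cos _))))).
  by field.
apply/is_derive_mxP => i j; rewrite (ord1 j) {j}.
pose k1 := cross w v; pose k2 := cross w k1.
have hk : cross w k2 = - th ^+ 2 *: k1.
  by rewrite hth; apply: col3P; rewrite /k2 /k1 /cross !(col3E, mxE)/=; ring.
have -> : turn w (sin (t * th) / th) ((1 - cos (t * th)) / th ^+ 2) k1 i 0 =
    cos (t * th) * k1 i 0 + sin (t * th) / th * k2 i 0.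
  by rewrite /turn -/k2 hk !mxE; field.
rewrite /turn -/k1 -/k2.
have E s : (v + (sin (s * th) / th) *: k1 +
      ((1 - cos (s * th)) / th ^+ 2) *: k2) i 0 =
    v i 0 + sin (s * th) / th * k1 i 0 + (1 - cos (s * th)) / th ^+ 2 * k2 i 0.
  by rewrite !mxE.
under eq_fun do rewrite E.
apply: (is_derive_eq (is_derive_funD (is_derive_funD (is_derive_cst _ _ _)
  (is_derive_funZr _ ds)) (is_derive_funZr _ dc))).
by rewrite add0r.
Qed.

End VectorCalculus.

(** * The equation of the profile *)

Section Profile.
Variables (R : realType) (I : set R) (y z : R -> R).
Hypothesis oI : open I.

Definition speed (x : R) : R := Num.sqrt (1 + derive1 y x ^+ 2 + derive1 z x ^+ 2).

Definition profile_equation (w : 'cV[R]_3) : Prop := forall x, I x ->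
  [/\ derivable y x 1, derivable z x 1, derivable (derive1 y) x 1, derivable (derive1 z) x 1 &
      cross (col3 1 (derive1 y x) (derive1 z x))
        (col3 0 (derive1 (derive1 y) x) (derive1 (derive1 z) x)) =
      speed x ^+ 3 *: cross w (profile y z x)].

Lemma speed_arg_gt0 x : 0 < 1 + derive1 y x ^+ 2 + derive1 z x ^+ 2.
Proof. by rewrite -addrA ltr_wpDr// addr_ge0// sqr_ge0. Qed.

Lemma speed_gt0 x : 0 < speed x.
Proof. by rewrite sqrtr_gt0 speed_arg_gt0. Qed.

Lemma is_derive_profile x : derivable y x 1 -> derivable z x 1 ->
  is_derive x 1 (profile y z) (col3 1 (derive1 y x) (derive1 z x)).
Proof.
move=> dy dz; exact: (is_derive_col3 (is_derive_id x (1 : R))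
  (is_derive_derive1 dy) (is_derive_derive1 dz)).
Qed.

(** The curve obtained from the profile by a fixed isometry [P]. *)
Section Moved.
Variable P : 'M[R]_3.
Hypothesis normP : forall v, eucl_norm (P *m v) = eucl_norm v.
Hypothesis crossP : forall u v, cross (P *m u) (P *m v) = P *m cross u v.
Hypothesis dy : forall x, I x -> derivable y x 1.
Hypothesis dz : forall x, I x -> derivable z x 1.

Let c x := P *m profile y z x.
Let T x := col3 1 (derive1 y x) (derive1 z x).

Lemma is_derive_moved x : I x -> is_derive x 1 c (P *m T x).
Proof.
by move=> Ix; apply: is_derive_mulmx; apply: is_derive_profile; [exact: dy|exact: dz].
Qed.

Lemma norm_tangent x : eucl_norm (P *m T x) = speed x.
Proof. by rewrite normP eucl_normE !col3E expr1n. Qed.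

Lemma derive1_moved_neq0 x : I x -> derive1 c x != 0.
Proof.
move=> Ix; rewrite (derive1_val (is_derive_moved Ix)); apply/negP => /eqP h.
have := speed_gt0 x; rewrite -norm_tangent h eucl_normE !mxE expr0n !addr0 sqrtr0.
by rewrite ltxx.
Qed.

(** The component of the derivative of the unit tangent along the tangent, which comes from
    differentiating [1 / speed], disappears in the cross product. *)
Lemma moved_binormal x : I x -> derivable (derive1 y) x 1 -> derivable (derive1 z) x 1 ->
  derivable (derive1 c) x 1 /\
  cross (arc_derive c c x) (arc_derive c (arc_derive c c) x) =
    (speed x) ^- 3 *: (P *m cross (T x) (col3 0 (derive1 (derive1 y) x) (derive1 (derive1 z) x))).
Proof.
move=> Ix dy1 dz1.
have nI : \forall t \near x, I t by exact: open_nbhs_nbhs.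
set T' := col3 0 _ _.
have dT : is_derive x 1 T T'.
  exact: (is_derive_col3 (is_derive_cst (1 : R) x (1 : R)) (is_derive_derive1 dy1)
    (is_derive_derive1 dz1)).
have nc : {near x, derive1 c =1 (fun t => P *m T t)}.
  by near=> t; apply: derive1_val; apply: is_derive_moved; near: t.
split.
  apply: (@near_eq_derivable _ _ _ (fun t => P *m T t)).
    by near=> t; symmetry; near: t.
  by case: (is_derive_mulmx P dT).
have na : {near x, (arc_derive c c) =1 (fun t => P *m ((speed t)^-1 *: T t))}.
  near=> t; rewrite /arc_derive.
  have -> : derive1 c t = P *m T t by near: t.
  by rewrite norm_tangent scalemxAr.
have ds : derivable (fun t => (speed t)^-1) x 1.
  have h : is_derive x 1 (fun t => 1 + derive1 y t ^+ 2 + derive1 z t ^+ 2)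
      (0 + 2 * derive1 y x * derive1 (derive1 y) x + 2 * derive1 z x * derive1 (derive1 z) x).
    exact: (is_derive_funD (is_derive_funD (is_derive_const _ _)
      (is_derive_sqr (is_derive_derive1 dy1))) (is_derive_sqr (is_derive_derive1 dz1))).
  have := is_derive_funV (is_derive_fun_sqrt h (speed_arg_gt0 x)) (lt0r_neq0 (speed_gt0 x)).
  by case.
have := is_derive_derive1 ds; set n' := derive1 _ x => dn.
have du : is_derive x 1 (fun t => (speed t)^-1 *: T t)
    (n' *: T x + (speed x)^-1 *: T').
  apply/is_derive_mxP => i j; under eq_fun do rewrite mxE.
  move/is_derive_mxP/(_ i j) : dT => dT.
  apply: (is_derive_eq (is_derive_funM dn dT)).
  by rewrite !mxE addrC.
have -> : arc_derive c (arc_derive c c) x =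
    (speed x)^-1 *: (P *m (n' *: T x + (speed x)^-1 *: T')).
  rewrite /arc_derive -/(arc_derive c c) (nbhs_singleton nc) norm_tangent.
  congr (_ *: _); apply: derive1_val.
  apply: near_eq_is_derive (is_derive_mulmx P du).
  by near=> t; symmetry; near: t.
rewrite (nbhs_singleton na) -scalemxAr crossZ crossP cross_comb -scalemxAr scalerA.
congr (_ *: _); field.
exact: lt0r_neq0 (speed_gt0 x).
Unshelve. all: by end_near. Qed.

End Moved.

(** Both sides of the vortex filament equation at time [t] are the images by [P t] of the
    same sides at time 0, and time 0 already carries all the regularity. *)
Lemma rotatingP (wx wy wz th : R) : th != 0 ->
  th ^+ 2 = wx ^+ 2 + wy ^+ 2 + wz ^+ 2 ->
  rotating I wx wy wz y z <-> profile_equation (col3 wx wz wy).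
Proof.
move=> th0 hth.
have hw : th ^+ 2 = (col3 wx wz wy) 0 0 ^+ 2 + (col3 wx wz wy) 1 0 ^+ 2 +
    (col3 wx wz wy) 2%:R 0 ^+ 2 by rewrite !col3E hth; ring.
pose P t := expmx (t *: angmx wx wy wz).
have PE t v : P t *m v = turn (col3 wx wz wy) (sin (t * th) / th)
    ((1 - cos (t * th)) / th ^+ 2) v by exact: expmx_angmx.
have coef t := @turn_coef _ th (t * th) th0.
have normP t v : eucl_norm (P t *m v) = eucl_norm v.
  by rewrite PE; apply: norm_turn; rewrite -hw.
have crossP t u v : cross (P t *m u) (P t *m v) = P t *m cross u v.
  by rewrite !PE; apply: cross_turn; rewrite -hw.
have dP (t : R) (v : 'cV[R]_3) : is_derive t 1 (fun s => P s *m v) (P t *m cross (col3 wx wz wy) v).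
  by rewrite PE; under eq_fun do rewrite PE; exact: is_derive_turn.
have P0 (v : 'cV[R]_3) : P 0 *m v = v.
  by rewrite PE mul0r sin0 cos0 subrr !mul0r /turn !scale0r !addr0.
split=> [rot x Ix|prof x t Ix].
- have dyz t : I t -> derivable y t 1 /\ derivable z t 1.
    move=> It; have [_ + _ _ _] := rot t 0 It.
    rewrite (_ : (fun _ => _) = profile y z); last by apply/funext => s; exact: P0.
    move/derivable_mxP => d; have := d 1 0; have := d 2%:R 0.
    by split; [apply: near_eq_derivable (d 1 0)|apply: near_eq_derivable (d 2%:R 0)];
      near=> s; rewrite mxE.
  have dy t (It : I t) := (dyz t It).1; have dz t (It : I t) := (dyz t It).2.
  have [_ _ d2 _ e] := rot x 0 Ix.
  have nI : \forall t \near x, I t by exact: open_nbhs_nbhs.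
  have d2E i : derivable (fun t => (P 0 *m col3 1 (derive1 y t) (derive1 z t)) i 0) x 1.
    move/derivable_mxP/(_ i 0) : d2; apply: near_eq_derivable; near=> t.
    have It : I t by near: t.
    by rewrite -(derive1_val (is_derive_moved (P 0) dy dz It)).
  have dy1 : derivable (derive1 y) x 1.
    by apply: near_eq_derivable (d2E 1); near=> t; rewrite P0 mxE.
  have dz1 : derivable (derive1 z) x 1.
    by apply: near_eq_derivable (d2E 2%:R); near=> t; rewrite P0 mxE.
  split; [exact: dy|exact: dz|by []|by []|].
  move: e; rewrite (derive1_val (dP _ _)).
  rewrite (moved_binormal (normP 0) (crossP 0) dy dz Ix dy1 dz1).2 !P0 => ->.
  by rewrite scalerA divff ?scale1r// expf_neq0// lt0r_neq0// speed_gt0.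
- have dy s (Is : I s) : derivable y s 1 by case: (prof s Is).
  have dz s (Is : I s) : derivable z s 1 by case: (prof s Is).
  have [_ _ dy1 dz1 e] := prof x Ix.
  have [d2 b] := moved_binormal (normP t) (crossP t) dy dz Ix dy1 dz1.
  split.
  + by case: (dP t (profile y z x)).
  + by case: (is_derive_moved (P t) dy dz Ix).
  + exact: d2.
  + exact: (derive1_moved_neq0 (normP t) dy dz Ix).
  + rewrite (derive1_val (dP _ _)) b e -scalemxAr scalerA mulVf ?scale1r//.
    by rewrite expf_neq0// lt0r_neq0// speed_gt0.
Unshelve. all: by end_near. Qed.

End Profile.

Lemma cross_col3 (R : realType) (a b c d e f : R) :
  cross (col3 a b c) (col3 d e f) =
  col3 (b * f - c * e) (c * d - a * f) (a * e - b * d).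
Proof. by rewrite /cross !col3E. Qed.

Lemma col3Z (R : realType) (k a b c : R) :
  k *: col3 a b c = col3 (k * a) (k * b) (k * c).
Proof. by apply: col3P; rewrite mxE !col3E. Qed.

Lemma col3_inj (R : realType) (a b c d e f : R) :
  col3 a b c = col3 d e f -> [/\ a = d, b = e & c = f].
Proof.
move=> h; have E i := congr1 (fun u : 'cV[R]_3 => u i 0) h.
by move: (E 0) (E 1) (E 2%:R); rewrite !col3E.
Qed.

Lemma cross_tangent2 (R : realType) (t d n u v : R) :
  t * 0 - 1 * d = n * (u - v) <-> d = n * (v - u).
Proof.
rewrite mulr0 mul1r sub0r -(opprB v u) mulrN.
by split=> [/oppr_inj|->].
Qed.

Lemma cross_tangent3 (R : realType) (t d u : R) : 1 * d - t * 0 = u <-> d = u.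
Proof. by rewrite mulr0 mul1r subr0. Qed.

Lemma profile_equationE (R : realType) (I : set R) (y z : R -> R) (a b c : R) :
  profile_equation I y z (col3 a b c) <-> forall x, I x ->
  [/\ derivable y x 1, derivable z x 1, derivable (derive1 y) x 1,
      derivable (derive1 z) x 1 &
    [/\ derive1 y x * derive1 (derive1 z) x - derive1 z x * derive1 (derive1 y) x =
          speed y z x ^+ 3 * (b * z x - c * y x),
        derive1 (derive1 z) x = speed y z x ^+ 3 * (a * z x - c * x) &
        derive1 (derive1 y) x = speed y z x ^+ 3 * (a * y x - b * x)]].
Proof.
have E x :
    cross (col3 1 (derive1 y x) (derive1 z x))
      (col3 0 (derive1 (derive1 y) x) (derive1 (derive1 z) x)) =
    speed y z x ^+ 3 *: cross (col3 a b c) (profile y z x) <->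
    [/\ derive1 y x * derive1 (derive1 z) x - derive1 z x * derive1 (derive1 y) x =
          speed y z x ^+ 3 * (b * z x - c * y x),
        derive1 (derive1 z) x = speed y z x ^+ 3 * (a * z x - c * x) &
        derive1 (derive1 y) x = speed y z x ^+ 3 * (a * y x - b * x)].
  rewrite /profile !cross_col3 col3Z.
  split=> [/col3_inj[e1 /cross_tangent2 e2 /cross_tangent3 e3]//|[e1 e2 e3]].
  congr col3; [exact: e1|by apply/cross_tangent2|by apply/cross_tangent3].
by split=> h x Ix; have [? ? ? ? /E] := h x Ix.
Qed.

Lemma speedC (R : realType) (y z : R -> R) x : speed y z x = speed z y x.
Proof. by rewrite /speed addrAC. Qed.

(** The exchange of [y] and [z] is a reflection, which reverses both cross products. *)
Lemma profile_equation_swap (R : realType) (I : set R) (y z : R -> R) (a b c : R) :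
  profile_equation I y z (col3 a b c) -> profile_equation I z y (col3 a c b).
Proof.
move=> /profile_equationE h; apply/profile_equationE => x Ix.
have [? ? ? ? [e1 e2 e3]] := h x Ix; split=> //; rewrite speedC.
by split; [rewrite -opprB e1 -mulrN opprB|exact: e3|exact: e2].
Qed.

(** * Rotation about a transverse axis *)

Section Transverse.
Variable R : realType.

(** [f / sqrt (k + f ^+ 2)] is the sine of the angle whose tangent is [f / sqrt k]. *)
Lemma is_derive_sine (k x d : R) (f : R -> R) : 0 < k -> is_derive x 1 f d ->
  is_derive x 1 (fun t => f t / Num.sqrt (k + f t ^+ 2))
    (k * d / Num.sqrt (k + f x ^+ 2) ^+ 3).
Proof.
move=> k0 df; have p0 : 0 < k + f x ^+ 2 by rewrite ltr_wpDr// sqr_ge0.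
have s0 : Num.sqrt (k + f x ^+ 2) != 0 by rewrite lt0r_neq0// sqrtr_gt0.
have h := is_derive_funM df (is_derive_funV (is_derive_fun_sqrt
  (is_derive_funD (is_derive_const _ k) (is_derive_sqr df)) p0) s0).
apply: (is_derive_eq h).
have kE : k = Num.sqrt (k + f x ^+ 2) ^+ 2 - f x ^+ 2.
  by rewrite sqr_sqrtr ?(ltW p0)//; ring.
by move: (Num.sqrt (k + f x ^+ 2)) s0 kE => s s0 ->; field.
Qed.

(** A slope is determined, smoothly, by the corresponding sine. *)
Lemma sine_inv (k p : R) : 0 < k ->
  let s := p / Num.sqrt (k + p ^+ 2) in
  0 < 1 - s ^+ 2 /\ p = Num.sqrt k * (s / Num.sqrt (1 - s ^+ 2)).
Proof.
move=> k0 s; have p0 : 0 < k + p ^+ 2 by rewrite ltr_wpDr// sqr_ge0.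
have s0 : Num.sqrt (k + p ^+ 2) != 0 by rewrite lt0r_neq0// sqrtr_gt0.
have E : 1 - s ^+ 2 = k / (k + p ^+ 2).
  by rewrite /s expr_div_n sqr_sqrtr ?(ltW p0)//; field; rewrite lt0r_neq0.
split; first by rewrite E divr_gt0.
rewrite E sqrtrM ?(ltW k0)// sqrtrV ?(ltW p0)// /s; field.
by rewrite s0 lt0r_neq0// sqrtr_gt0.
Qed.

(** With [y'' = 0] and [C1 = y'], the first equation is [C1] times the second except that [y]
    replaces [C1 x]; hence [y = C1 x], and the second integrates by [is_derive_sine]. *)
Lemma transverseP (w : R) (I : set R) (y z : R -> R) : w != 0 -> open_interval I ->
  profile_equation I y z (col3 0 0 w) <->
  exists C1 C2, (forall x, I x -> y x = C1 * x) /\ ode_transverse w C1 C2 I z.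
Proof.
move=> w0 [oI iI [x0 Ix0]].
have k_gt0 := @add1_sqr_gt0 R.
split=> [/profile_equationE h|[C1 [C2 [yE ode]]]].
- have y1 x : I x -> derive1 y x = derive1 y x0.
    move=> Ix; apply: (constant_of_is_derive0 iI) => // t It.
    have [_ _ dy1 _ [_ _ e]] := h t It.
    by apply: (is_derive_eq (is_derive_derive1 dy1)); rewrite e !mul0r subrr mulr0.
  set C1 := derive1 y x0 in y1; set k := 1 + C1 ^+ 2.
  have N0 x : speed y z x != 0 by rewrite lt0r_neq0// speed_gt0.
  have yE x : I x -> y x = C1 * x.
    move=> Ix; have [_ _ _ _ [e1 e2 e3]] := h x Ix.
    have : (speed y z x ^+ 3 * w) * (y x - C1 * x) = 0.
      move: e1; rewrite e3 e2 y1// => e1.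
      rewrite -(subrr (speed y z x ^+ 3 * (0 * z x - w * y x))) -{1}e1.
      by move: (speed y z x ^+ 3) (y x) (z x) (derive1 z x) => N a b c; ring.
    have nz : speed y z x ^+ 3 * w != 0 by rewrite mulf_neq0// expf_neq0.
    by move/eqP; rewrite mulf_eq0 (negPf nz)/= subr_eq0 => /eqP.
  pose F x := - (derive1 z x / Num.sqrt (k + derive1 z x ^+ 2)) - 2^-1 * k * w * x ^+ 2.
  have dF x : I x -> is_derive x 1 F 0.
    move=> Ix; have [_ _ _ dz1 [_ e _]] := h x Ix.
    have h1 := is_derive_sine (k_gt0 C1) (is_derive_derive1 dz1).
    have h2 := is_derive_funB (is_deriveN h1)
      (is_derive_funZ (2^-1 * k * w) (is_derive_sqr (is_derive_id x (1 : R)))).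
    apply: (is_derive_eq h2); rewrite e.
    have -> : speed y z x = Num.sqrt (1 + C1 ^+ 2 + derive1 z x ^+ 2).
      by rewrite /speed y1.
    have : Num.sqrt (k + derive1 z x ^+ 2) != 0.
      by rewrite lt0r_neq0// sqrtr_gt0 ltr_wpDr ?sqr_ge0 ?k_gt0.
    by rewrite -/k; move: (Num.sqrt (k + _)) (z x) => N a n0; field.
  exists C1, (F x0 / k); split=> // x Ix; split; first by case: (h x Ix).
  have : F x = F x0 by exact: (constant_of_is_derive0 iI dF).
  rewrite {1}/F -/k => <-; have := lt0r_neq0 (k_gt0 C1); rewrite -/k.
  by move: (derive1 z x / _) => q k0; field.
- set k := 1 + C1 ^+ 2 in ode *.
  pose g x := 2^-1 * k * (w * x ^+ 2 + 2 * C2).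
  have dg (x : R) : is_derive x 1 g (k * w * x).
    apply: (is_derive_eq (is_derive_funZ (2^-1 * k) (is_derive_funD (is_derive_funZ w
      (is_derive_sqr (is_derive_id x (1 : R)))) (is_derive_const x (2 * C2))))).
    by field.
  have kp : 0 < k by exact: k_gt0.
  have sE t : I t -> 0 < 1 - g t ^+ 2 /\
      - Num.sqrt k * (g t / Num.sqrt (1 - g t ^+ 2)) = derive1 z t.
    move=> It; have [_ e] := ode t It; rewrite -/k -/(g t) in e.
    have [] := @sine_inv k (derive1 z t) kp.
    have -> : derive1 z t / Num.sqrt (k + derive1 z t ^+ 2) = - g t by rewrite -e opprK.
    by rewrite sqrrN => ? ->; rewrite !mulNr mulrN.
  have dz1 x : I x -> derivable (derive1 z) x 1.
    move=> Ix; have [s0 _] := sE x Ix.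
    have r0 : Num.sqrt (1 - g x ^+ 2) != 0 by rewrite lt0r_neq0// sqrtr_gt0.
    have d := is_derive_funZ (- Num.sqrt k) (is_derive_funM (dg x) (is_derive_funV
      (is_derive_fun_sqrt (is_derive_funB (is_derive_const x 1) (is_derive_sqr (dg x)))
      s0) r0)).
    by have [] := is_derive_open oI Ix (fun t It => (sE t It).2) d.
  have y1 x : I x -> is_derive x 1 y C1.
    move=> Ix; have d := is_derive_funZ C1 (is_derive_id x (1 : R)).
    rewrite mulr1 in d; exact: (is_derive_open oI Ix (fun t It => esym (yE t It)) d).
  have y2 x : I x -> is_derive x 1 (derive1 y) 0.
    move=> Ix; apply: (is_derive_open oI Ix _ (is_derive_const x C1)) => t It.
    by rewrite (derive1_val (y1 t It)).
  apply/profile_equationE => x Ix; have [dz e] := ode x Ix.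
  have E : derive1 (derive1 z) x = - speed y z x ^+ 3 * w * x.
    have h1 := is_deriveN (is_derive_sine kp (is_derive_derive1 (dz1 x Ix))).
    have h2 : is_derive x 1
        (fun t => - (derive1 z t / Num.sqrt (k + derive1 z t ^+ 2))) (k * w * x).
      apply: (is_derive_open oI Ix _ (dg x)) => t It.
      by case: (ode t It) => _ ->.
    have := derive1_val h1; rewrite (derive1_val h2).
    have -> : speed y z x = Num.sqrt (k + derive1 z x ^+ 2).
      by rewrite /speed (derive1_val (y1 x Ix)).
    have N0 : Num.sqrt (k + derive1 z x ^+ 2) != 0.
      by rewrite lt0r_neq0// sqrtr_gt0 ltr_wpDr// sqr_ge0.
    move: N0; set N := Num.sqrt _ => N0 e2.
    have k0 := lt0r_neq0 kp.
    apply: (mulfI k0); apply: (mulIf (invr_neq0 (expf_neq0 3 N0))).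
    rewrite -[LHS]opprK -e2; field; exact: N0.
  split; [by case: (y1 x Ix)|by []|by case: (y2 x Ix)|exact: dz1|].
  rewrite (derive1_val (y1 x Ix)) (derive1_val (y2 x Ix)) E yE//.
  by move: (speed y z x) (derive1 z x) => N p; split; ring.
Qed.

End Transverse.

(** * Rotation about the x-axis *)

Section Axial.
Variable R : realType.
Implicit Types (I : set R) (f y z : R -> R) (w l k C : R).

(** If [z x1 != 0], the difference [y - l z] with [l = y x1 / z x1] solves the linear equation
    of [y] and [z], vanishes at [x1], and so does its derivative since the Wronskian of
    [y] and [z] is zero. *)
Lemma axial_proportional I y z e : e != 0 -> open_interval I ->
  profile_equation I y z (col3 e 0 0) ->
  (exists l, forall x, I x -> y x = l * z x) \/ (forall x, I x -> z x = 0).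
Proof.
move=> e0 [oI iI _] /profile_equationE h.
have [z0|/existsNP[x1 /not_implyP[Ix1 /eqP zx1]]] :=
  pselect (forall x, I x -> z x = 0); first by right.
left; exists (y x1 / z x1); set l := y x1 / z x1.
have W x : I x -> derive1 y x * z x = derive1 z x * y x.
  move=> Ix; have [_ _ _ _ [e1 e2 e3]] := h x Ix.
  have nz : speed y z x ^+ 3 * e != 0.
    by rewrite mulf_neq0// expf_neq0// lt0r_neq0// speed_gt0.
  apply: (mulfI nz); apply/eqP; rewrite -subr_eq0; apply/eqP.
  move: e1; rewrite e2 e3 => e1.
  rewrite -[RHS](subrr (speed y z x ^+ 3 * (0 * z x - 0 * y x))) -{1}e1.
  by move: (speed y z x ^+ 3) (y x) (z x) (derive1 z x) (derive1 y x) => N a b c d; ring.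
have dspeed x : I x -> {for x, continuous (fun t => e * speed y z t ^+ 3)}.
  move=> Ix; have [_ _ dy1 dz1 _] := h x Ix.
  have ds := is_derive_fun_sqrt (is_derive_funD (is_derive_funD
    (is_derive_const x 1) (is_derive_sqr (is_derive_derive1 dy1)))
    (is_derive_sqr (is_derive_derive1 dz1))) (speed_arg_gt0 y z x).
  exact: (is_derive_continuous (is_derive_funZ e (is_derive_funM ds (is_derive_sqr ds)))).
suff E x : I x -> y x - l * z x = 0.
  by move=> x /E /eqP; rewrite subr_eq0 => /eqP.
move: x; apply: (@linear_ode2_unique R I (fun x => y x - l * z x)
  (fun x => derive1 y x - l * derive1 z x) (fun x => e * speed y z x ^+ 3) x1) => //.
- move=> x Ix; have [dy dz _ _ _] := h x Ix.
  exact: (is_derive_funB (is_derive_derive1 dy) (is_derive_funZ l (is_derive_derive1 dz))).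
- move=> x Ix; have [_ _ dy1 dz1 [_ e2 e3]] := h x Ix.
  apply: (is_derive_eq (is_derive_funB (is_derive_derive1 dy1)
    (is_derive_funZ l (is_derive_derive1 dz1)))).
  by rewrite e2 e3; move: (speed y z x ^+ 3) => N; ring.
- by rewrite /l divfK// subrr.
- apply: (mulIf zx1); rewrite mulrBl W// mul0r /l; move: zx1 => zx1.
  by field.
Qed.

(** What [profile_equation] becomes for the plane curve [(x, l f, f)], with [k = 1 + l ^+ 2]:
    the curvature is [e] times the signed distance to the axis, as for an elastica. *)
Definition bending I e k f := forall x, I x ->
  [/\ derivable f x 1, derivable (derive1 f) x 1 &
      derive1 (derive1 f) x = e * Num.sqrt (1 + k * derive1 f x ^+ 2) ^+ 3 * f x].

Lemma bendingP I e l y z : open I -> (forall x, I x -> y x = l * z x) ->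
  profile_equation I y z (col3 e 0 0) <-> bending I e (1 + l ^+ 2) z.
Proof.
move=> oI yE.
have dy x : I x -> derivable z x 1 -> is_derive x 1 y (l * derive1 z x).
  move=> Ix dz; apply: (is_derive_open oI Ix _ (is_derive_funZ l (is_derive_derive1 dz))).
  by move=> t /yE.
have sE x : I x -> derivable z x 1 ->
    speed y z x = Num.sqrt (1 + (1 + l ^+ 2) * derive1 z x ^+ 2).
  by move=> Ix dz; rewrite /speed (derive1_val (dy x Ix dz)); congr Num.sqrt; ring.
split=> [/profile_equationE h x Ix|h].
  have [_ dz _ dz1 [_ e2 _]] := h x Ix; split=> //.
  by rewrite e2 sE// mul0r subr0 [RHS]mulrAC mulrC.
apply/profile_equationE => x Ix; have [dz dz1 e2] := h x Ix.
have dy1 : is_derive x 1 (derive1 y) (l * derive1 (derive1 z) x).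
  apply: (is_derive_open oI Ix _ (is_derive_funZ l (is_derive_derive1 dz1))).
  by move=> t It; have [dzt _ _] := h t It; rewrite (derive1_val (dy t It dzt)).
split; [by case: (dy x Ix dz)|exact: dz|by case: dy1|exact: dz1|].
rewrite (derive1_val dy1) (derive1_val (dy x Ix dz)) sE// e2 yE//.
by move: (z x) (derive1 z x) (Num.sqrt (1 + _)) => a b N; split; ring.
Qed.

Section Energy.
Variables (w l C : R) (I : set R) (f : R -> R).
Hypotheses (w0 : w != 0) (oI : open I) (iI : is_interval I).
Let k := 1 + l ^+ 2.
Let Q u := k * (w * u ^+ 2 + 2 * C).

Let k_gt0 : 0 < k := add1_sqr_gt0 l.

(** The equation [ode_axial] freed of square roots and quotients: [2 / |Q|] is the
    speed of the curve. *)
Lemma ode_axialP : ode_axial w l C I f <-> forall x, I x ->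
  derivable f x 1 /\ Q (f x) ^+ 2 * (1 + k * derive1 f x ^+ 2) = 4.
Proof.
have k0 := lt0r_neq0 k_gt0.
have SE u : w * u ^+ 2 + 2 * C != 0 ->
    forall p, p ^+ 2 = slope2_axial w l C u <-> Q u ^+ 2 * (1 + k * p ^+ 2) = 4.
  move=> q0 p; rewrite /slope2_axial -/k /Q; move: (_ + 2 * C) q0 => q q0.
  have d0 : k ^+ 3 * q ^+ 2 != 0 by rewrite mulf_neq0 ?expf_neq0.
  split=> [->|e]; first by field; rewrite q0 k0.
  apply: (mulIf d0); rewrite divfK// -e; ring.
split=> h x Ix.
  have [df q0 s0 e] := h x Ix; split=> //; apply/SE => //.
  by case: e => ->; rewrite ?sqrrN sqr_sqrtr.
have [df e] := h x Ix.
have q0 : w * f x ^+ 2 + 2 * C != 0.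
  by apply/eqP => q0; move: e; rewrite /Q q0 mulr0 expr0n mul0r => /eqP; rewrite eq_sym pnatr_eq0.
move/SE : e => /(_ q0) e; split=> //; first by rewrite -e sqr_ge0.
rewrite -e sqrtr_sqr; case: (leP 0 (derive1 f x)) => s.
  by left; rewrite ger0_norm.
by right; rewrite ltr0_norm// opprK.
Qed.

Hypothesis ode : forall x, I x ->
  derivable f x 1 /\ Q (f x) ^+ 2 * (1 + k * derive1 f x ^+ 2) = 4.

Lemma axial_Q_neq0 x : I x -> Q (f x) != 0.
Proof.
move=> Ix; apply/eqP => q0; have [_] := ode Ix.
by rewrite q0 expr0n mul0r => /eqP; rewrite eq_sym pnatr_eq0.
Qed.

Lemma axial_slope x : I x -> derive1 f x ^+ 2 = (4 / Q (f x) ^+ 2 - 1) / k.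
Proof.
move=> Ix; have q0 := axial_Q_neq0 Ix; have [_ <-] := ode Ix.
have k0 := lt0r_neq0 k_gt0.
by move: (Q _) (derive1 f x) q0 => q p q0; field; rewrite q0 k0.
Qed.

Lemma axial_critical x : I x -> derive1 f x = 0 <-> Q (f x) ^+ 2 = 4.
Proof.
move=> Ix; split=> [e|e].
  by have [_] := ode Ix; rewrite e expr0n mulr0 addr0 mulr1.
by apply/eqP; rewrite -sqrf_eq0 axial_slope// e divff ?subrr ?mul0r.
Qed.

Lemma is_derive_axialQ (x d : R) : is_derive x 1 f d ->
  is_derive x 1 (fun t => Q (f t)) (k * w * (2 * f x * d)).
Proof.
move=> df; apply: (is_derive_eq (is_derive_funZ k (is_derive_funD
  (is_derive_funZ w (is_derive_sqr df)) (is_derive_const x (2 * C))))).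
by ring.
Qed.

Let is_derive_f x (Ix : I x) := is_derive_derive1 (ode Ix).1.

Let G u := - (8 * w * u) / Q u ^+ 3.

Lemma continuous_axial x : I x -> {for x, continuous f}.
Proof. by move=> Ix; exact: (is_derive_continuous (is_derive_f Ix)). Qed.

Lemma continuous_axialQ x : I x -> {for x, continuous (fun t => Q (f t))}.
Proof. by move=> Ix; exact: (is_derive_continuous (is_derive_axialQ (is_derive_f Ix))). Qed.

(** Dividing this by [2 f'] shows what [f''] must be. *)
Lemma is_derive_slope2 x : I x ->
  is_derive x 1 (fun t => (4 / Q (f t) ^+ 2 - 1) / k) (2 * derive1 f x * G (f x)).
Proof.
move=> Ix; have q0 := axial_Q_neq0 Ix; have k0 := lt0r_neq0 k_gt0.
have dQ := is_derive_axialQ (is_derive_f Ix).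
apply: (is_derive_eq (is_derive_funZr k^-1 (is_derive_funB (is_derive_funZ 4
  (is_derive_funV (is_derive_sqr dQ) (expf_neq0 2 q0))) (is_derive_const x 1)))).
rewrite /G; move: (derive1 f x) (f x) (Q (f x)) q0 => p u q q0.
by field; rewrite q0 k0.
Qed.

(** Near [x], [f'] is one of the two square roots of a positive function. *)
Lemma axial_regular x : I x -> derive1 f x != 0 ->
  is_derive x 1 (derive1 f) (G (f x)).
Proof.
move=> Ix p0; pose S t := (4 / Q (f t) ^+ 2 - 1) / k.
have SE t : I t -> derive1 f t ^+ 2 = S t by exact: axial_slope.
have S0 : 0 < S x by rewrite -SE// lt_def sqr_ge0 sqrf_eq0 p0.
have dS := is_derive_slope2 Ix.
have nS : \forall t \near x, I t /\ 0 < S t.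
  near=> t; split; near: t; first exact: open_nbhs_nbhs.
  exact: (cvgr_gt _ (is_derive_continuous dS)).
have /nbhs_ballP[r /= r0 hr] := nS.
have inI t : x - r < t < x + r -> I t /\ 0 < S t.
  by move=> /andP[a b]; apply: hr; rewrite /ball/= ltr_norml; apply/andP; split; lra.
have xr : x - r < x < x + r by rewrite ltrBlDr ltrDl r0.
have sg : exists2 s : R, s ^+ 2 = 1 & forall t, x - r < t < x + r ->
    derive1 f t = s * Num.sqrt (S t).
  have nz t : x - r < t < x + r -> derive1 f t != 0.
    by move=> /inI[It St]; rewrite -sqrf_eq0 SE// lt0r_neq0.
  have [pos|neg] := @derive_constant_sign _ f (derive1 f) (x - r) (x + r)
    (fun t ht => is_derive_f (inI t ht).1) nz.
  - exists 1 => [|t ht]; first by rewrite expr1n.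
    by rewrite -(SE t (inI t ht).1) sqrtr_sqr gtr0_norm ?pos// mul1r.
  - exists (- 1) => [|t ht]; first by rewrite sqrrN expr1n.
    by rewrite -(SE t (inI t ht).1) sqrtr_sqr ltr0_norm ?neg// mulN1r opprK.
have [s s1 sE] := sg.
have d := is_derive_funZ s (is_derive_fun_sqrt dS S0).
have -> : G (f x) = s * (2 * derive1 f x * G (f x) / (2 * Num.sqrt (S x))).
  have := sE x xr; have := sqrtr_gt0 (S x); rewrite S0 => /lt0r_neq0.
  move: (Num.sqrt _) => r1 r10 ->; rewrite -[LHS]mul1r -{1}s1.
  by move: (G _) => g; field.
apply: (near_eq_is_derive _ d); apply/nbhs_ballP; exists r => //= t.
rewrite /ball/= ltr_norml => /andP[a b]; rewrite sE//.
by apply/andP; split; lra.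
Unshelve. all: by end_near. Qed.

(** At a critical point on the axis, [f' ^ 2] vanishes like [f ^ 2], so that [f] vanishes
    identically by Gronwall. *)
Lemma axial_critical_on_axis x : I x -> derive1 f x = 0 -> f x = 0 ->
  forall t, I t -> f t = 0.
Proof.
move=> Ix p0 f0 t It; have k0 := lt0r_neq0 k_gt0.
have C4 : (k * (2 * C)) ^+ 2 = 4.
  by move/(axial_critical Ix) : p0; rewrite /Q f0 expr0n mulr0 add0r.
pose q s := - (k * w) * (w * f s ^+ 2 + 4 * C) * (Q (f s) ^+ 2)^-1.
have qE s : I s -> derive1 f s ^+ 2 = q s * f s ^+ 2.
  move=> Is; rewrite axial_slope// /q -{1}C4; have := axial_Q_neq0 Is; rewrite /Q.
  rewrite mulf_eq0 negb_or => /andP[_]; move: (f s) => u q0; field.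
  by rewrite q0 k0.
apply/eqP; rewrite -sqrf_eq0; apply/eqP; move: t It.
apply: (@gronwall _ I (fun s => f s ^+ 2) (fun s => 2 * f s * derive1 f s)
   (fun s => 1 + `|q s|) x) => //.
- by move=> s Is; exact: (is_derive_sqr (is_derive_f Is)).
- move=> s Is; apply: cvgD; first exact: cvg_cst.
  apply: cvg_norm.
  apply: (is_derive_continuous (is_derive_funM (is_derive_funZ (- (k * w))
    (is_derive_funD (is_derive_funZ w (is_derive_sqr (is_derive_f Is)))
      (is_derive_const s (4 * C))))
    (is_derive_funV (is_derive_sqr (is_derive_axialQ (is_derive_f Is)))
      (expf_neq0 2 (axial_Q_neq0 Is))))).
- by move=> s _; rewrite sqr_ge0.
- move=> s Is; apply: (@le_trans _ _ (f s ^+ 2 + derive1 f s ^+ 2)).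
    have := sqr_ge0 (f s - derive1 f s); have := sqr_ge0 (f s + derive1 f s).
    move: (f s) (derive1 f s) => a b ? ?.
    by rewrite ler_norml; apply/andP; split; lra.
  rewrite qE// mulrDl mul1r lerD2l ler_wpM2r ?sqr_ge0// ler_norm//.
- by rewrite f0 expr0n.
Qed.

(** All critical points near [x0] have the same height: there [Q (f) ^+ 2 = 4], and [Q (f)] and
    [f] keep the signs that they have at [x0].  Between two critical points the extrema
    of [f] are again critical or at the ends, so [f] would be constant. *)
Lemma axial_critical_isolated x0 : I x0 -> derive1 f x0 = 0 -> f x0 != 0 ->
  nowhere_constant I f ->
  exists2 r, 0 < r & forall t, `|x0 - t| < r -> I t /\ (t != x0 -> derive1 f t != 0).
Proof.
move=> Ix0 p0 f0 nc.
have k0 := lt0r_neq0 k_gt0.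
have : \forall t \near x0, [/\ I t, 0 < f t * f x0 & 0 < Q (f t) * Q (f x0)].
  near=> t; split; near: t; first exact: open_nbhs_nbhs.
  - apply: (cvgr_gt (f x0 * f x0)); last by rewrite -expr2 lt_def sqr_ge0 sqrf_eq0 f0.
    by apply: cvgMr_tmp; exact: continuous_axial.
  - apply: (cvgr_gt (Q (f x0) * Q (f x0))).
      by apply: cvgMr_tmp; exact: continuous_axialQ.
    by rewrite -expr2 lt_def sqr_ge0 sqrf_eq0 (axial_Q_neq0 Ix0).
move=> /nbhs_ballP[r /= r0 hr]; exists r => // t tr.
split=> [|tx]; first by case: (hr t tr).
have crit c : `|x0 - c| < r -> derive1 f c = 0 -> f c = f x0.
  move=> /hr[Ic s1 s2] /(axial_critical Ic) e.
  have e0 := (axial_critical Ix0).1 p0.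
  have : (Q (f c) - Q (f x0)) * (Q (f c) + Q (f x0)) = 0 by rewrite -subr_sqr e e0 subrr.
  move=> /eqP; rewrite mulf_eq0 => /orP[|/eqP e1]; last first.
    by exfalso; move: s2; rewrite -(addrK (Q (f x0)) (Q (f c))) e1; nra.
  rewrite subr_eq0 => /eqP; rewrite /Q => /(mulfI k0) /addIr /(mulfI w0) e2.
  have : (f c - f x0) * (f c + f x0) = 0 by rewrite -subr_sqr e2 subrr.
  move=> /eqP; rewrite mulf_eq0 => /orP[|/eqP e3]; first by rewrite subr_eq0 => /eqP.
  by exfalso; move: s1; rewrite -(addrK (f x0) (f c)) e3; nra.
apply/negP => /eqP pt.
have [a [b [ab ar br fa fb]]] : exists a b, [/\ a < b, `|x0 - a| < r, `|x0 - b| < r,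
    f a = f x0 & f b = f x0].
  have ft := crit t tr pt; have x0r : `|x0 - x0| < r by rewrite subrr normr0.
  by have [h|h|h] := ltgtP t x0; [exists t, x0|exists x0, t|rewrite h eqxx in tx].
have seg c : a <= c <= b -> `|x0 - c| < r.
  move: ar br; rewrite !ltr_norml => /andP[? ?] /andP[? ?] /andP[? ?].
  by apply/andP; split; lra.
have segI c : a <= c <= b -> I c by move=> /seg /hr[].
have cf : {within `[a, b], continuous f}.
  exact: (is_derive_within (fun c hc => is_derive_f (segI c hc))).
have oo c : c \in `]a, b[ -> a <= c <= b.
  by rewrite in_itv/= => /andP[/ltW -> /ltW ->].
have dab c : c \in `]a, b[ -> derivable f c 1 by move=> /oo /segI Ic; case: (ode Ic).
have ext c : c \in `[a, b] -> (c \in `]a, b[ -> is_derive c 1 f 0) -> f c = f x0.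
  rewrite !in_itv/= => /andP[ac cb] h.
  have [->//|ca] := eqVneq c a; have [->//|cb'] := eqVneq c b.
  have ci : a < c < b by rewrite !lt_neqAle ac cb cb' eq_sym ca.
  by apply: crit; [apply: seg; rewrite ac|exact: derive1_val (h ci)].
have [cM cMab maxf] := EVT_max (ltW ab) cf.
have [cm cmab minf] := EVT_min (ltW ab) cf.
have EM : f cM = f x0.
  apply: ext => // ci; apply: (derive1_at_max (ltW ab) dab ci) => s /oo ss.
  by apply: maxf; rewrite in_itv.
have Em : f cm = f x0.
  apply: ext => // ci; apply: (derive1_at_min (ltW ab) dab ci) => s /oo ss.
  by apply: minf; rewrite in_itv.
have [|u [v [uI vI]]] := nc a b ab; first by move=> c /=; rewrite in_itv/=; exact: segI.
have fE s : s \in `[a, b] -> f s = f x0.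
  by move=> sI; apply/le_anti; rewrite -{1}EM maxf// -Em minf.
by rewrite !fE// eqxx.
Unshelve. all: by end_near. Qed.

(** At a critical point, both [f'] and [G (f)] are continuous and [is_derive_extend] applies. *)
Lemma axial_second x : nowhere_constant I f -> I x ->
  is_derive x 1 (derive1 f) (G (f x)).
Proof.
move=> nc Ix; have [p0|p0] := eqVneq (derive1 f x) 0; last exact: axial_regular.
have f0 : f x != 0.
  apply/eqP => f0; have fE := axial_critical_on_axis Ix p0 f0.
  have : nbhs x I by exact: open_nbhs_nbhs.
  move=> /nbhs_ballP[r /= r0 hr].
  have [||u [v [uI vI]]] := nc x (x + r / 2); first by rewrite ltrDl divr_gt0.
    move=> c /=; rewrite in_itv/= => /andP[xc cx]; apply: hr; rewrite /ball/=.
    by rewrite ler0_norm ?subr_le0//; lra.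
  have sI s : s \in `[x, x + r / 2] -> I s.
    rewrite in_itv/= => /andP[xc cx]; apply: hr; rewrite /ball/=.
    by rewrite ler0_norm ?subr_le0//; lra.
  by rewrite !fE ?eqxx//; exact: sI.
have [r r0 iso] := axial_critical_isolated Ix p0 f0 nc.
apply: (@is_derive_extend _ (derive1 f) (fun t => G (f t)) x r) => //.
- by move=> t tr tx; have [It pt] := iso t tr; apply: axial_regular => //; exact: pt.
- apply/cvgrPdist_lt => e e0; rewrite p0.
  have cS := is_derive_continuous (is_derive_slope2 Ix).
  have S0 : (4 / Q (f x) ^+ 2 - 1) / k = 0.
    by rewrite -axial_slope// p0 expr0n.
  have : \forall t \near x, I t /\ (4 / Q (f t) ^+ 2 - 1) / k < e ^+ 2.
    near=> t; split; near: t; first exact: open_nbhs_nbhs.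
    by apply: (cvgr_lt _ cS); rewrite S0 exprn_gt0.
  apply: filterS => t [It]; rewrite -axial_slope// sub0r normrN => h.
  by rewrite -(ltr_pXn2r (n := 2)) ?nnegrE ?(ltW e0)// real_normK ?num_real.
- exact: (is_derive_continuous (is_derive_funM (is_deriveN (is_derive_funZ (8 * w)
   (is_derive_f Ix))) (is_derive_funV (is_derive_funM (is_derive_axialQ (is_derive_f Ix))
   (is_derive_sqr (is_derive_axialQ (is_derive_f Ix)))) (expf_neq0 3 (axial_Q_neq0 Ix))))).
Unshelve. all: by end_near. Qed.

End Energy.
End Axial.

Section Bending.
Variables (R : realType) (w : R) (w0 : w != 0).

Lemma bending_zero (I : set R) (e k : R) (f : R -> R) : open I ->
  (forall x, I x -> f x = 0) -> bending I e k f.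
Proof.
move=> oI f0 x Ix.
have d1 t : I t -> is_derive t 1 f 0.
  by move=> It; apply: (is_derive_open oI It _ (is_derive_const t 0)) => s /f0.
have d2 : is_derive x 1 (derive1 f) 0.
  apply: (is_derive_open oI Ix _ (is_derive_const x 0)) => s Is.
  by rewrite (derive1_val (d1 s Is)).
by split; [case: (d1 x Ix)|case: d2|rewrite (derive1_val d2) f0// mulr0].
Qed.

(** [- 8 w f / Q ^ 3] is [- s w N ^ 3 f] where [s] is the sign of [Q] and [N = 2 / |Q|]. *)
Lemma bending_of_ode (l C : R) (I : set R) (f : R -> R) : open I -> is_interval I ->
  ode_axial w l C I f -> nowhere_constant I f ->
  bending I w (1 + l ^+ 2) f \/ bending I (- w) (1 + l ^+ 2) f.
Proof.
move=> oI iI /ode_axialP ode nc; set k := 1 + l ^+ 2 in ode *.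
pose q x := k * (w * f x ^+ 2 + 2 * C).
have cq x : I x -> {for x, continuous q} by exact: (continuous_axialQ ode).
have q0 x : I x -> q x != 0 by exact: (axial_Q_neq0 ode).
have key s : s ^+ 2 = 1 -> (forall x, I x -> 0 < s * q x) -> bending I (- (s * w)) k f.
  move=> s1 pos x Ix; have d2 := axial_second w0 oI iI ode nc Ix.
  have [df e] := ode x Ix; split; [by []|by case: d2|].
  rewrite (derive1_val d2) -/(q x).
  have E : s * q x * Num.sqrt (1 + k * derive1 f x ^+ 2) = 2.
    have p0 : 0 <= 1 + k * derive1 f x ^+ 2.
      by rewrite addr_ge0// mulr_ge0 ?sqr_ge0// ltW// add1_sqr_gt0.
    apply/eqP; rewrite -(eqrXn2 (n := 2))//; last first.
      by rewrite mulr_ge0 ?sqrtr_ge0// ltW// pos.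
    by rewrite !exprMn s1 mul1r sqr_sqrtr// -/(q x) in e *; rewrite e -natrX.
  have s0 : s != 0 by rewrite -sqrf_eq0 s1 oner_eq0.
  have := q0 x Ix; move: E; move: (Num.sqrt _) (q x) => N q1 E q10.
  have -> : N = 2 / (s * q1) by rewrite -E; field; rewrite s0 q10.
  have -> : s * w = s ^+ 3 * w by rewrite exprS s1 mulr1.
  by field; rewrite s0 q10.
have [pos|neg] := continuous_constant_sign iI cq q0.
  by right; rewrite -[w]mul1r; apply: key => [|x /pos]; rewrite ?expr1n ?mul1r.
left; rewrite -[w]opprK -(mulN1r w); apply: key => [|x /neg]; first by rewrite sqrrN expr1n.
by rewrite mulN1r oppr_gt0.
Qed.

(** Multiply the equation by [k f' / N ^ 3], where [N] is the square root. *)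
Lemma bending_energy (e k : R) (I : set R) (f : R -> R) : 0 < k -> is_interval I ->
  bending I e k f -> I !=set0 -> exists c, forall x, I x ->
  (Num.sqrt (1 + k * derive1 f x ^+ 2))^-1 + 2^-1 * k * e * f x ^+ 2 = c.
Proof.
move=> k0 iI b [x0 Ix0].
pose F x := (Num.sqrt (1 + k * derive1 f x ^+ 2))^-1 + 2^-1 * k * e * f x ^+ 2.
exists (F x0) => x Ix; apply: (constant_of_is_derive0 iI (f := F)) => // t It.
have [df df1 e2] := b t It.
have p0 : 0 < 1 + k * derive1 f t ^+ 2.
  by rewrite ltr_pwDl// mulr_ge0 ?sqr_ge0// ltW.
have s0 : Num.sqrt (1 + k * derive1 f t ^+ 2) != 0 by rewrite lt0r_neq0// sqrtr_gt0.
apply: (is_derive_eq (is_derive_funD (is_derive_funV (is_derive_fun_sqrt (is_derive_funD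
  (is_derive_const t 1) (is_derive_funZ k (is_derive_sqr (is_derive_derive1 df1)))) p0) s0)
  (is_derive_funZ (2^-1 * k * e) (is_derive_sqr (is_derive_derive1 df))))).
rewrite e2; move: (f t) (derive1 f t) (Num.sqrt (1 + _)) s0 => u p N N0.
by field.
Qed.

(** Where [f] is constant, [f'' = 0] makes it zero; then it is zero everywhere because the
    equation is linear in [f] once [f'] is known. *)
Lemma bending_genuine (e k : R) (I : set R) (f : R -> R) : 0 < k -> e != 0 ->
  is_interval I -> bending I e k f -> genuine I f.
Proof.
move=> k0 e0 iI b; have [nc|nnc] := pselect (nowhere_constant I f); first by right.
left; have [a [b' [ab abI fE]]] : exists a b', [/\ a < b', [set` `[a, b']] `<=` I &
    forall u v, u \in `[a, b'] -> v \in `[a, b'] -> f u = f v].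
  apply: contra_notP nnc => h a c ac acI; apply: contra_notP h => h.
  exists a, c; split=> // u v uI vI; apply/eqP/negPn/negP => uv; apply: h.
  by exists u, v.
pose m := (a + b') / 2.
have mI c : a < c < b' -> I c.
  by move=> /andP[/ltW ac /ltW cb]; apply: abI; rewrite /= in_itv/= ac.
have oab : open [set c | a < c < b'].
  by have := @interval_open R (BRight a) (BLeft b') isT isT; rewrite set_itvoo.
have mab : a < m < b' by rewrite /m; apply/andP; split; lra.
have d1 t : a < t < b' -> is_derive t 1 f 0.
  move=> tab; apply: (@is_derive_open _ _ (fun=> f m) _ _ _ oab tab _ (is_derive_const t (f m))).
  by move=> s /andP[as_ sb]; apply: fE; rewrite in_itv/= ?(ltW as_) ?(ltW sb)//;
     move: mab => /andP[/ltW -> /ltW ->].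
have d2 : is_derive m 1 (derive1 f) 0.
  apply: (is_derive_open oab mab _ (is_derive_const m 0)) => s sab.
  by rewrite (derive1_val (d1 s sab)).
have [_ _] := b m (mI m mab); rewrite (derive1_val d2) (derive1_val (d1 m mab)).
rewrite expr0n mulr0 addr0 sqrtr1 expr1n mulr1 => /esym/eqP.
rewrite mulf_eq0 (negPf e0)/= => /eqP fm0.
apply: (@linear_ode2_unique R I f (derive1 f)
  (fun x => e * Num.sqrt (1 + k * derive1 f x ^+ 2) ^+ 3) m iI).
- by move=> x Ix; have [df _ _] := b x Ix; exact: is_derive_derive1.
- by move=> x Ix; have [_ df1 <-] := b x Ix; exact: is_derive_derive1.
- move=> x Ix; have [_ df1 _] := b x Ix.
  have p0 : 0 < 1 + k * derive1 f x ^+ 2.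
    by rewrite ltr_pwDl// mulr_ge0 ?sqr_ge0// ltW.
  have ds := is_derive_fun_sqrt (is_derive_funD (is_derive_const x 1)
    (is_derive_funZ k (is_derive_sqr (is_derive_derive1 df1)))) p0.
  exact: (is_derive_continuous (is_derive_funZ e (is_derive_funM ds (is_derive_sqr ds)))).
- exact: mI.
- exact: fm0.
- by rewrite (derive1_val (d1 m mab)).
Qed.

(** With [e = s * w], [s = 1] or [s = - 1], and [c] the constant of [bending_energy], the
    choice [C = - s c / k] makes [Q = - 2 s / N], and squaring removes [s]. *)
Lemma ode_of_bending (e l : R) (I : set R) (f : R -> R) : is_interval I -> I !=set0 ->
  e = w \/ e = - w -> bending I e (1 + l ^+ 2) f -> exists C, ode_axial w l C I f.
Proof.
move=> iI I0 ew b; have k0 := add1_sqr_gt0 l; have kn := lt0r_neq0 k0.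
have [c cE] := bending_energy k0 iI b I0.
have [s s1 es] : exists2 s : R, s ^+ 2 = 1 & e = s * w.
  case: ew => ->; first by exists 1; rewrite ?expr1n ?mul1r.
  by exists (- 1); rewrite ?sqrrN ?expr1n ?mulN1r.
exists (- (s * c) / (1 + l ^+ 2)); apply/ode_axialP => x Ix.
have [df _ _] := b x Ix; split=> //.
have p0 : 0 < 1 + (1 + l ^+ 2) * derive1 f x ^+ 2.
  by rewrite ltr_pwDl// mulr_ge0 ?sqr_ge0// ltW.
have s0 : Num.sqrt (1 + (1 + l ^+ 2) * derive1 f x ^+ 2) != 0.
  by rewrite lt0r_neq0// sqrtr_gt0.
rewrite -(sqr_sqrtr (ltW p0)) -(cE x Ix) es.
move: (1 + l ^+ 2) (Num.sqrt _) s0 kn => k N N0 kn.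
have -> : k * (w * f x ^+ 2 + 2 * (- (s * (N^-1 + 2^-1 * k * (s * w) * f x ^+ 2)) / k)) =
    (1 - s ^+ 2) * k * w * f x ^+ 2 - 2 * s / N by field; rewrite kn N0.
by rewrite s1 subrr !mul0r sub0r sqrrN !exprMn s1 mulr1 exprVn mulfVK ?expf_neq0// -natrX.
Qed.

End Bending.

(** * Parameters and uniqueness *)

Section Families.
Variables (R : realType) (w : R).
Hypothesis (w0 : w != 0).
Implicit Types (I : set R) (f g : R -> R).

Lemma transverse_parameters (C1 C2 D1 D2 : R) I f : open_interval I ->
  ode_transverse w C1 C2 I f -> ode_transverse w D1 D2 I f ->
  (forall x, I x -> C1 * x = D1 * x) -> C1 = D1 /\ C2 = D2.
Proof.
move=> oI odeC odeD h; have [x Ix x0] := open_interval_point_neq0 oI.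
have E := mulIf x0 (h x Ix); split=> //; subst D1.
have [_ eC] := odeC x Ix; have [_ eD] := odeD x Ix.
have k0 : 1 + C1 ^+ 2 != 0 by rewrite lt0r_neq0// add1_sqr_gt0.
have two : (2 : R)^-1 != 0 by rewrite invr_eq0 pnatr_eq0.
have /(mulfI (mulf_neq0 two k0)) : 2^-1 * (1 + C1 ^+ 2) * (w * x ^+ 2 + 2 * C2) =
  2^-1 * (1 + C1 ^+ 2) * (w * x ^+ 2 + 2 * D2) by rewrite -eC eD.
by move/addrI; apply: mulfI; rewrite pnatr_eq0.
Qed.

(** The equation determines the derivative. *)
Lemma transverse_translation (C1 C2 : R) I f g : open_interval I ->
  ode_transverse w C1 C2 I f -> ode_transverse w C1 C2 I g ->
  exists c : R, forall x, I x -> f x = g x + c.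
Proof.
move=> [oI iI [x0 Ix0]] odef odeg.
have k0 := add1_sqr_gt0 C1.
exists (f x0 - g x0) => x Ix.
suff -> : f x0 - g x0 = f x - g x by rewrite addrC subrK.
apply: (constant_of_is_derive0 iI (f := fun t => f t - g t)) => // t It.
have [df ef] := odef t It; have [dg eg] := odeg t It.
apply: (is_derive_eq (is_derive_funB (is_derive_derive1 df) (is_derive_derive1 dg))).
have [_] := sine_inv (derive1 f t) k0; have [_] := sine_inv (derive1 g t) k0.
by move: ef; rewrite -eg => /oppr_inj -> {1}<- {1}<-; rewrite subrr.
Qed.

(** If [C1 != D1], eliminating [f'] between the two equations leaves
    [w f ^+ 2 = - (C1 + D1)]. *)
Lemma axial_parameters (l m C1 D1 : R) I f : open_interval I ->
  ode_axial w l C1 I f -> ode_axial w m D1 I f -> nowhere_constant I f ->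
  (forall x, I x -> l * f x = m * f x) -> l = m /\ C1 = D1.
Proof.
move=> oI /ode_axialP odeC odeD nc h; have [a [b [ab abI]]] := open_interval_segment oI.
have [u [v [/abI uI /abI vI uv]]] := nc a b ab abI.
have lm : l = m.
  have [fu|fu] := eqVneq (f u) 0; last exact: (mulIf fu (h u uI)).
  by apply: (mulIf (_ : f v != 0) (h v vI)); rewrite -fu eq_sym.
subst m; split=> //; move/ode_axialP: odeD => odeD.
have k_gt0 := add1_sqr_gt0 l; have k0 := lt0r_neq0 k_gt0.
apply/eqP; apply: contraT => CD.
have f2 x : I x -> w * f x ^+ 2 = - (C1 + D1).
  move=> Ix; have [_ eC] := odeC x Ix; have [_ eD] := odeD x Ix.
  have n0 : 1 + (1 + l ^+ 2) * derive1 f x ^+ 2 != 0.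
    by rewrite lt0r_neq0// ltr_pwDl// mulr_ge0 ?sqr_ge0// ltW.
  have : ((1 + l ^+ 2) * (w * f x ^+ 2 + 2 * C1)) ^+ 2 =
      ((1 + l ^+ 2) * (w * f x ^+ 2 + 2 * D1)) ^+ 2.
    by apply: (mulIf n0); rewrite eC eD.
  rewrite !exprMn => /(mulfI (expf_neq0 2 k0)) e.
  have : (C1 - D1) * (w * f x ^+ 2 + (C1 + D1)) = 0.
    move: e; move: (w * _) => q e; nra.
  by move/eqP; rewrite mulf_eq0 subr_eq0 (negPf CD)/= addr_eq0 => /eqP.
have sq x : I x -> f x ^+ 2 = f u ^+ 2 by move=> Ix; apply: (mulfI w0); rewrite !f2.
have fu : f u != 0.
  apply: contra_neq uv => fu; have /eqP := sq v vI.
  by rewrite fu expr0n sqrf_eq0 => /eqP.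
have [oI' iI _] := oI.
have d0 x : I x -> is_derive x 1 f 0.
  move=> Ix; have [df _] := odeC x Ix.
  have fx : f x != 0 by rewrite -sqrf_eq0 sq// sqrf_eq0.
  have d1 := is_derive_sqr (is_derive_derive1 df).
  have d2 := is_derive_open oI' Ix (fun t It => esym (sq t It)) (is_derive_const x (f u ^+ 2)).
  have := derive1_val d1; rewrite (derive1_val d2) => /esym/eqP.
  rewrite !mulf_eq0 pnatr_eq0 (negPf fx)/= => /eqP e.
  by rewrite -e; exact: is_derive_derive1.
by move: uv; rewrite (constant_of_is_derive0 iI d0 uI vI) eqxx.
Qed.

(** The quotient [p] of [G (f) - G (g)] by [f - g] is written as a fraction without
    singularity at [f = g]. *)
Lemma axial_unique (l C x0 : R) I f g : open_interval I -> I x0 ->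
  ode_axial w l C I f -> ode_axial w l C I g ->
  nowhere_constant I f -> nowhere_constant I g ->
  f x0 = g x0 -> derive1 f x0 = derive1 g x0 -> forall x, I x -> f x = g x.
Proof.
move=> [oI iI _] Ix0 /ode_axialP odef /ode_axialP odeg ncf ncg e0 e1.
set k := 1 + l ^+ 2 in odef odeg.
pose q (h : R -> R) t := k * (w * h t ^+ 2 + 2 * C).
have qf t : I t -> q f t != 0 by exact: (axial_Q_neq0 odef).
have qg t : I t -> q g t != 0 by exact: (axial_Q_neq0 odeg).
pose p t := - (8 * w) * (q g t * q g t ^+ 2 - k * w * (g t * (f t + g t)) *
   (q f t ^+ 2 + q f t * q g t + q g t ^+ 2)) * (q f t ^+ 3 * q g t ^+ 3)^-1.
suff E x : I x -> f x - g x = 0 by move=> x /E /eqP; rewrite subr_eq0 => /eqP.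
move: x; apply: (@linear_ode2_unique R I (fun t => f t - g t)
  (fun t => derive1 f t - derive1 g t) p x0 iI).
- move=> t It; have [df _] := odef t It; have [dg _] := odeg t It.
  exact: (is_derive_funB (is_derive_derive1 df) (is_derive_derive1 dg)).
- move=> t It.
  have d2f := axial_second w0 oI iI odef ncf It.
  have d2g := axial_second w0 oI iI odeg ncg It.
  apply: (is_derive_eq (is_derive_funB d2f d2g)).
  rewrite /p; have := qf t It; have := qg t It; rewrite /q -/k.
  move: (f t) (g t) => u v qv0 qu0.
  by field; move: qu0 qv0; rewrite !mulf_eq0 !negb_or => /andP[-> ->] /andP[_ ->].
- move=> t It; have [df _] := odef t It; have [dg _] := odeg t It.
  have cf := is_derive_derive1 df; have cg := is_derive_derive1 dg.
  have dqf := is_derive_axialQ w l C cf; have dqg := is_derive_axialQ w l C cg.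
  have nz : q f t ^+ 3 * q g t ^+ 3 != 0 by rewrite mulf_neq0 ?expf_neq0 ?qf ?qg.
  exact: (is_derive_continuous (is_derive_funM (is_derive_funZ (- (8 * w))
    (is_derive_funB (is_derive_funM dqg (is_derive_sqr dqg))
      (is_derive_funM (is_derive_funZ (k * w) (is_derive_funM cg (is_derive_funD cf cg)))
        (is_derive_funD (is_derive_funD (is_derive_sqr dqf) (is_derive_funM dqf dqg))
          (is_derive_sqr dqg)))))
    (is_derive_funV (is_derive_funM (is_derive_funM dqf (is_derive_sqr dqf))
       (is_derive_funM dqg (is_derive_sqr dqg))) nz))).
- exact: Ix0.
- by rewrite e0 subrr.
- by rewrite e1 subrr.
Qed.

End Families.

(** * Local existence *)

Lemma local_primitive (R : realType) (h : R -> R) (a b : R) :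
  (forall x, a <= x <= b -> {for x, continuous h}) ->
  exists F, forall x, a < x < b -> is_derive x 1 F (h x).
Proof.
move=> ch; pose F (x : R) := (\int[lebesgue_measure]_(t in `[a, x]) h t)%R.
exists F => x /andP[ax xb]; apply/is_derive1E.
apply: (@continuous_FTC1_closed _ h a x b xb) => //.
  apply: continuous_compact_integrable; first exact: segment_compact.
  apply: continuous_in_subspaceT => t; rewrite inE/= in_itv/=; exact: ch.
by apply: ch; rewrite !ltW.
Qed.

(** Separation of variables: the solution is an inverse function of the primitive of
    [1 / v]. *)
Lemma autonomous_ode_exists (R : realType) (v : R -> R) (z0 x0 r : R) : 0 < r ->
  (forall u, `|z0 - u| <= r -> 0 < v u /\ {for u, continuous v}) ->
  exists g d, [/\ 0 < d, g x0 = z0 & forall x, x0 - d < x < x0 + d ->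
     `|z0 - g x| < r /\ is_derive x 1 g (v (g x))].
Proof.
move=> r0 hv.
have cl u : z0 - r <= u <= z0 + r -> `|z0 - u| <= r.
  by move=> /andP[? ?]; rewrite ler_norml; apply/andP; split; lra.
have op u : `|z0 - u| < r -> z0 - r < u < z0 + r.
  by rewrite ltr_norml => /andP[? ?]; apply/andP; split; lra.
have op' u : z0 - r < u < z0 + r -> `|z0 - u| < r.
  by move=> /andP[? ?]; rewrite ltr_norml; apply/andP; split; lra.
have [|F0 dF0] := @local_primitive R (fun u => (v u)^-1) (z0 - r) (z0 + r).
  move=> u /cl /hv[v0 cv]; apply: cvgV => //; exact: lt0r_neq0.
pose F u := F0 u - F0 z0 + x0.
have dF u : z0 - r < u < z0 + r -> is_derive u 1 F (v u)^-1.
  move=> /dF0 d; apply: (is_derive_eq (is_derive_funD (is_derive_funB d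
    (is_derive_const u (F0 z0))) (is_derive_const u x0))).
  by rewrite subr0 addr0.
have vi0 u : z0 - r < u < z0 + r -> (v u)^-1 != 0.
  by move=> /op' /ltW /hv[v0 _]; rewrite invr_eq0 lt0r_neq0.
(* the default value [z0] only matters outside the range of [F] *)
pose g y := xget z0 [set u | z0 - r < u < z0 + r /\ F u = y].
have gK u : z0 - r < u < z0 + r -> g (F u) = u.
  move=> ur; have := @xgetI R z0 [set s | z0 - r < s < z0 + r /\ F s = F u] u (conj ur erefl).
  by rewrite -/(g (F u)) => -[gr]; apply: (injective_of_derive_neq0 dF vi0).
have [oB zB] := open_interval_around z0 r0; have [oI _ _] := oB.
have near_in u : z0 - r < u < z0 + r -> \forall t \near u, z0 - r < t < z0 + r.
  by move=> ur; apply: open_nbhs_nbhs.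
have nK u : z0 - r < u < z0 + r -> {near u, cancel F g}.
  by move=> ur; near=> t; apply: gK; near: t; exact: near_in.
have nC u : z0 - r < u < z0 + r -> {near u, continuous F}.
  move=> ur; near=> t; have tr : z0 - r < t < z0 + r by near: t; exact: near_in.
  exact: (is_derive_continuous (dF t tr)).
have Fz0 : F z0 = x0 by rewrite /F subrr add0r.
have [cg gF] := near_can_continuousAcan_sym (nK z0 zB) (nC z0 zB).
rewrite Fz0 in cg gF.
have gz0 : g x0 = z0 by rewrite -Fz0 gK.
have : \forall x \near x0, F (g x) = x /\ z0 - r < g x < z0 + r.
  near=> x; split; first by near: x.
  near: x; have := nbhs_singleton cg; rewrite /continuous_at gz0 => cz.
  exact: (cz _ (near_in z0 zB)).
move=> /nbhs_ballP[d /= d0 hd]; exists g, d; split=> // x /andP[x1 x2].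
have [Fg gr] : F (g x) = x /\ z0 - r < g x < z0 + r.
  by apply: hd; rewrite /ball/= ltr_norml; apply/andP; split; lra.
split; first exact: op'.
have := is_derive_inverse (nK _ gr) (nC _ gr) (dF _ gr) (vi0 _ gr).
by rewrite Fg invrK.
Unshelve. all: by end_near. Qed.

Section Existence.
Variables (R : realType) (w : R).

(** Inverse of [sine_inv]. *)
Lemma sine_of (k s : R) : 0 < k -> 0 < 1 - s ^+ 2 ->
  let p := Num.sqrt k * (s / Num.sqrt (1 - s ^+ 2)) in
  p / Num.sqrt (k + p ^+ 2) = s.
Proof.
move=> k0 s0 p; have r0 : Num.sqrt (1 - s ^+ 2) != 0 by rewrite lt0r_neq0// sqrtr_gt0.
have q0 : Num.sqrt k != 0 by rewrite lt0r_neq0// sqrtr_gt0.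
have -> : k + p ^+ 2 = k / (1 - s ^+ 2).
  rewrite /p !exprMn exprVn !sqr_sqrtr ?ltW//; field; exact: lt0r_neq0.
rewrite sqrtrM ?ltW// sqrtrV ?ltW// /p; field.
by rewrite q0 r0.
Qed.

Lemma transverse_exists (C1 C2 x0 : R) :
  (1 + C1 ^+ 2) * `|w * x0 ^+ 2 + 2 * C2| < 2 ->
  exists (I : set R) (f : R -> R),
    [/\ open_interval I, I x0 & ode_transverse w C1 C2 I f].
Proof.
set k := 1 + C1 ^+ 2 => h; have k0 : 0 < k := add1_sqr_gt0 C1.
pose s (x : R) := - (2^-1 * k * (w * x ^+ 2 + 2 * C2)).
have ds (x : R) : is_derive x 1 s (- (2^-1 * k * (w * (2 * x * 1) + 0))).
  exact: (is_deriveN (is_derive_funZ (2^-1 * k) (is_derive_funD (is_derive_funZ w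
      (is_derive_sqr (is_derive_id x (1 : R)))) (is_derive_const x (2 * C2))))).
have d1 x := is_derive_funB (is_derive_const x 1) (is_derive_sqr (ds x)).
have s0 : 0 < 1 - s x0 ^+ 2.
  have : `|s x0| < 1 by rewrite normrN !normrM (gtr0_norm k0) ger0_norm ?invr_ge0//; lra.
  by rewrite ltr_norml => /andP[? ?]; nra.
have : \forall x \near x0, 0 < 1 - s x ^+ 2.
  exact: (cvgr_gt _ (is_derive_continuous (d1 x0))).
move=> /nbhs_ballP[r /= r0 hr].
have r20 : 0 < r / 2 by rewrite divr_gt0.
have inr x : x0 - r / 2 <= x <= x0 + r / 2 -> 0 < 1 - s x ^+ 2.
  move=> /andP[? ?]; apply: hr; rewrite /ball/= ltr_norml; apply/andP; split; lra.
have [|F dF] := @local_primitive R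
    (fun x => Num.sqrt k * (s x / Num.sqrt (1 - s x ^+ 2))) (x0 - r / 2) (x0 + r / 2).
  move=> x /inr sx; have q0 : Num.sqrt (1 - s x ^+ 2) != 0 by rewrite lt0r_neq0// sqrtr_gt0.
  exact: (is_derive_continuous (is_derive_funZ (Num.sqrt k) (is_derive_funM (ds x)
    (is_derive_funV (is_derive_fun_sqrt (d1 x) sx) q0)))).
have [oI xI] := open_interval_around x0 r20.
exists [set x | x0 - r / 2 < x < x0 + r / 2], F; split=> // x xr.
have d := dF x xr; split; first by case: d.
rewrite (derive1_val d) sine_of//; first by rewrite opprK.
by apply: inr; move: xr => /andP[/ltW -> /ltW ->].
Qed.

(** Where the right-hand side is positive, the equation with a fixed sign is autonomous; the
    sign is a reversal of the parameter. *)
Lemma axial_exists (l C1 x0 z0 : R) (neg : bool) :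
  0 < (1 + l ^+ 2) * `|w * z0 ^+ 2 + 2 * C1| < 2 ->
  exists (I : set R) (f : R -> R),
    [/\ open_interval I /\ I x0, ode_axial w l C1 I f,
        nowhere_constant I f, f x0 = z0 &
        derive1 f x0 = (-1) ^+ neg * Num.sqrt (slope2_axial w l C1 z0)].
Proof.
move=> /andP[h0 h2]; set k := 1 + l ^+ 2 in h0 h2; have k0 : 0 < k := add1_sqr_gt0 l.
have kn := lt0r_neq0 k0.
pose Q u := k * (w * u ^+ 2 + 2 * C1).
pose S u := (4 / Q u ^+ 2 - 1) / k.
have dQ (u : R) := is_derive_axialQ w l C1 (is_derive_id u (1 : R)).
have Qn : Q z0 != 0.
  by rewrite -normr_eq0 /Q normrM (gtr0_norm k0) lt0r_neq0.
have SE u : Q u != 0 -> slope2_axial w l C1 u = S u.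
  rewrite /Q mulf_eq0 negb_or /slope2_axial /S /Q -/k => /andP[_].
  by move: (_ + 2 * C1) => q q0; field; rewrite q0 kn.
have dS u : Q u != 0 -> exists d, is_derive u 1 S d.
  move=> q0; eexists.
  exact: (is_derive_funZr k^-1 (is_derive_funB (is_derive_funZ 4
    (is_derive_funV (is_derive_sqr (dQ u)) (expf_neq0 2 q0))) (is_derive_const u 1))).
have S0 : 0 < S z0.
  rewrite divr_gt0// subr_gt0 ltr_pdivlMr ?mul1r ?exprn_even_gt0//.
  have : `|Q z0| < 2 by rewrite /Q normrM (gtr0_norm k0).
  by rewrite ltr_norml => /andP[? ?]; nra.
have : \forall u \near z0, 0 < S u /\ 0 < Q u * Q z0.
  have [d dSz] := dS z0 Qn.
  near=> u; split; near: u; first exact: (cvgr_gt _ (is_derive_continuous dSz)).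
  apply: (cvgr_gt (Q z0 * Q z0)); last by rewrite -expr2 exprn_even_gt0.
  by apply: cvgMr_tmp; exact: (is_derive_continuous (dQ z0)).
move=> /nbhs_ballP[r /= r0 hr].
pose sg : R := (-1) ^+ neg.
have r20 : 0 < r / 2 by rewrite divr_gt0.
have inr u : `|z0 - u| <= r / 2 -> 0 < S u /\ Q u != 0.
  move=> ur; have [|Su Qu] := hr u; first by rewrite /ball/=; lra.
  by split=> //; apply/eqP => q0; move: Qu; rewrite q0 mul0r ltxx.
have [|g [d [d0 g0 hg]]] :=
    @autonomous_ode_exists R (fun u => Num.sqrt (S u)) z0 0 (r / 2) r20.
  move=> u /inr[Su Qu]; have [dd dSu] := dS u Qu; split; first by rewrite sqrtr_gt0.
  exact: (is_derive_continuous (is_derive_fun_sqrt dSu Su)).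
have [oI xI] := open_interval_around x0 d0.
have sg2 : sg ^+ 2 = 1 by rewrite /sg sqrr_sign.
pose f x := g (sg * (x - x0)).
have inI x : x0 - d < x < x0 + d -> 0 - d < sg * (x - x0) < 0 + d.
  rewrite /sg => /andP[? ?]; case: (neg); rewrite ?expr1 ?expr0;
  by apply/andP; split; lra.
have df x : x0 - d < x < x0 + d -> is_derive x 1 f (sg * Num.sqrt (S (f x))).
  move=> xI'; have [_ dg] := hg _ (inI x xI').
  apply: (is_derive_eq (is_derive_fun_comp (is_derive_funZ sg (is_derive_funB
    (is_derive_id x (1 : R)) (is_derive_const x x0))) dg)).
  by rewrite subr0 mulr1 mulrC.
have fI x : x0 - d < x < x0 + d -> 0 < S (f x) /\ Q (f x) != 0.
  by move=> /inI /hg[/ltW /inr].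
have fx0 : f x0 = z0 by rewrite /f subrr mulr0.
exists [set x | x0 - d < x < x0 + d], f; split=> //.
- apply/ode_axialP => x xI'; have [Sx Qx] := fI x xI'.
  have dfx := df x xI'; split; first by case: dfx.
  have -> : derive1 f x ^+ 2 = S (f x).
    by rewrite (derive1_val dfx) exprMn sg2 mul1r sqr_sqrtr// ltW.
  rewrite -/k -/(Q (f x)) /S; move: (Q _) Qx => q q0; field.
  by rewrite q0 kn.
- move=> a b ab abI; exists a, b; split; rewrite ?in_itv/= ?lexx ?(ltW ab)//.
  apply/eqP => fab.
  have aI := abI a; rewrite /= in_itv/= lexx (ltW ab) in aI.
  have bI := abI b; rewrite /= in_itv/= lexx (ltW ab) in bI.
  have nz x : x0 - d < x < x0 + d -> sg * Num.sqrt (S (f x)) != 0.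
    move=> /fI[Sx _]; rewrite mulf_neq0 ?signr_eq0//.
    by rewrite lt0r_neq0// sqrtr_gt0.
  have := injective_of_derive_neq0 df nz (aI isT) (bI isT) fab.
  by move=> e; rewrite e ltxx in ab.
- by rewrite (derive1_val (df x0 xI)) fx0 SE.
Unshelve. all: by end_near. Qed.

End Existence.

(** * The theorem *)

Section Classification.
Variables (R : realType) (w : R).
Hypothesis w0 : w != 0.

Lemma rotating_axialP (I : set R) (y z : R -> R) (e : R) : open I -> e != 0 ->
  rotating I e 0 0 y z <-> profile_equation I y z (col3 e 0 0).
Proof. by move=> oI e0; apply: (rotatingP _ _ oI e0); rewrite expr0n !addr0. Qed.

(** The proportion [l] being known, only the scalar equation of [z] is left. *)
Lemma rotating_proportionalP (I : set R) (l : R) (y z : R -> R) : open_interval I ->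
  (forall x, I x -> y x = l * z x) ->
  (profile_equation I y z (col3 w 0 0) \/ profile_equation I y z (col3 (- w) 0 0)) <->
  exists C, ode_axial w l C I z /\ genuine I z.
Proof.
move=> [oI iI I0] yE; have bE e := bendingP e oI yE.
have k0 := add1_sqr_gt0 l.
split=> [h|[C [ode [f0|nc]]]].
- have [e [ew b]] : exists e, (e = w \/ e = - w) /\ bending I e (1 + l ^+ 2) z.
    by case: h => /bE b; [exists w|exists (- w)]; split=> //; [left|right].
  have e0 : e != 0 by case: ew => ->; rewrite ?oppr_eq0.
  have [C ode] := ode_of_bending iI I0 ew b.
  by exists C; split=> //; exact: (bending_genuine k0 e0 iI b).
- by left; apply/bE; exact: bending_zero.
- by case: (bending_of_ode w0 oI iI ode nc) => b; [left|right]; apply/bE.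
Qed.

Lemma axialP (I : set R) (y z : R -> R) : open_interval I ->
  (rotating I w 0 0 y z \/ rotating I (- w) 0 0 y z) <->
  (exists l C1 : R, [/\ forall x, I x -> y x = l * z x,
                        ode_axial w l C1 I z & genuine I z]) \/
  ((forall x, I x -> z x = 0) /\
   exists C1 : R, ode_axial w 0 C1 I y /\ genuine I y).
Proof.
move=> oI; have [oI' iI I0] := oI.
have wN0 : - w != 0 by rewrite oppr_eq0.
have rE e (e0 : e != 0) : rotating I e 0 0 y z <-> _ := rotating_axialP y z oI' e0.
have zE : (forall x, I x -> z x = 0) -> forall x, I x -> z x = 0 * y x.
  by move=> z0 x Ix; rewrite mul0r z0.
split=> [h|[[l [C [yE ode gen]]]|[z0 [C og]]]].
- have {}h : profile_equation I y z (col3 w 0 0) \/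
      profile_equation I y z (col3 (- w) 0 0).
    by case: h => /rE h; [left; exact: h|right; exact: h].
  have [[l yE]|z0] : (exists l, forall x, I x -> y x = l * z x) \/
      (forall x, I x -> z x = 0).
    by case: h => h; [exact: (axial_proportional w0 oI h)|
                      exact: (axial_proportional wN0 oI h)].
  + by left; have [C [ode gen]] := (rotating_proportionalP oI yE).1 h; exists l, C.
  + right; split=> //; apply/(rotating_proportionalP oI (zE z0)).
    by case: h => h; [left|right]; exact: profile_equation_swap.
- have /(rotating_proportionalP oI yE) h : exists C, ode_axial w l C I z /\ genuine I z.
    by exists C.
  by case: h => h; [left|right]; apply/rE.
- have /(rotating_proportionalP oI (zE z0)) h :
    exists C, ode_axial w 0 C I y /\ genuine I y by exists C.
  by case: h => /profile_equation_swap h; [left|right]; apply/rE.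
Qed.

End Classification.

Theorem theorem3p4p1 (R : realType) (w : R) (hw : w != 0) :
  (* the two cases *)
  (forall (I : set R) (y z : R -> R), open_interval I ->
    [/\ (* (1), rotation around the y-axis *)
        rotating I 0 w 0 y z <->
          (exists C1 C2 : R, (forall x, I x -> y x = C1 * x) /\
                             ode_transverse w C1 C2 I z),
        (* (1), rotation around the z-axis *)
        rotating I 0 0 w y z <->
          (exists C1 C2 : R, (forall x, I x -> z x = C1 * x) /\
                             ode_transverse w C1 C2 I y) &
        (* (2), rotation around the x-axis; the second alternative is the
           limit value lambda = oo *)
        (rotating I w 0 0 y z \/ rotating I (- w) 0 0 y z) <->
          (exists l C1 : R, [/\ forall x, I x -> y x = l * z x,
                                ode_axial w l C1 I z & genuine I z]) \/
          ((forall x, I x -> z x = 0) /\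
           exists C1 : R, ode_axial w 0 C1 I y /\ genuine I y)])
  /\
  (* (1) is a family with the two parameters C1, C2, up to translation along
     the axis of rotation *)
  [/\ forall C1 C2 x0 : R,
        (1 + C1 ^+ 2) * `|w * x0 ^+ 2 + 2 * C2| < 2 ->
        exists (I : set R) (f : R -> R),
          [/\ open_interval I, I x0 & ode_transverse w C1 C2 I f],
      forall (C1 C2 D1 D2 : R) (I : set R) (f : R -> R), open_interval I ->
        ode_transverse w C1 C2 I f -> ode_transverse w D1 D2 I f ->
        (forall x, I x -> C1 * x = D1 * x) -> C1 = D1 /\ C2 = D2 &
      forall (C1 C2 : R) (I : set R) (f g : R -> R), open_interval I ->
        ode_transverse w C1 C2 I f -> ode_transverse w C1 C2 I g ->
        exists c : R, forall x, I x -> f x = g x + c]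
  /\
  (* (2) is a family with the three parameters lambda, C1 and z(x0), up to the
     sign in the equation *)
  [/\ forall (l C1 x0 z0 : R) (neg : bool),
        0 < (1 + l ^+ 2) * `|w * z0 ^+ 2 + 2 * C1| < 2 ->
        exists (I : set R) (f : R -> R),
          [/\ open_interval I /\ I x0, ode_axial w l C1 I f,
              nowhere_constant I f, f x0 = z0 &
              derive1 f x0 = (-1) ^+ neg * Num.sqrt (slope2_axial w l C1 z0)],
      forall (l m C1 D1 : R) (I : set R) (f : R -> R), open_interval I ->
        ode_axial w l C1 I f -> ode_axial w m D1 I f -> nowhere_constant I f ->
        (forall x, I x -> l * f x = m * f x) -> l = m /\ C1 = D1 &
      forall (l C1 x0 : R) (I : set R) (f g : R -> R), open_interval I -> I x0 ->
        ode_axial w l C1 I f -> ode_axial w l C1 I g ->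
        nowhere_constant I f -> nowhere_constant I g ->
        f x0 = g x0 -> derive1 f x0 = derive1 g x0 ->
        forall x, I x -> f x = g x].
Proof.
split; [|split].
- move=> I y z oI; have [oI' _ _] := oI; split; last exact: axialP.
  + apply: (iff_trans (rotatingP y z oI' hw _)); last exact: transverseP.
    by rewrite expr0n add0r addr0.
  + apply: (iff_trans (rotatingP y z oI' hw _)); first by rewrite expr0n !add0r.
    apply: iff_trans (transverseP z y hw oI).
    by split; exact: profile_equation_swap.
- split.
  + exact: transverse_exists.
  + exact: transverse_parameters.
  + exact: transverse_translation.
- split.
  + exact: axial_exists.
  + exact: axial_parameters.
  + exact: axial_unique.
Qed.
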